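(* If $G$ has Kazhdan's property (T), then for every generating probability measure $\mu$ on $G$ the set of ergodic actions is nowhere dense in $A_\mu(G,X,\nu)$ endowed with the weak topology.
   Context: $G$ is a countable discrete group; $\mu$ is a probability measure on $G$ whose support generates $G$ as a semigroup. $(X,\nu)$ is a standard nonatomic Lebesgue probability space. $\mathrm{Aut}^*(X,\nu)$ is the group of invertible nonsingular transformations $T$ of $(X,\nu)$ (i.e. $T_*\nu\sim\nu$), modulo equality a.e. For $T\in\mathrm{Aut}^*(X,\nu)$ let $U_{T,1}f=\frac{dT_*\nu}{d\nu}\cdot f\circ T^{-1}$, an isometry of $L^1(X,\nu)$. The weak topology on $\mathrm{Aut}^*(X,\nu)$ is the one in which $T_n\to T$ iff $\|U_{T_n,1}\mathbf 1_A-U_{T,1}\mathbf 1_A\|_1\to0$ for every measurable $A\subseteq X$ (the topology induced by the strong operator topology on isometries of $L^1$). $A^*(G,X,\nu)$ is the set of homomorphisms $a:G\to\mathrm{Aut}^*(X,\nu)$ with the topology of pointwise convergence, and $A_\mu(G,X,\nu)$ is its subspace of $\mu$-stationary actions, i.e. those with $\sum_{g}\mu(g)a(g)_*\nu=\nu$. An action $a$ is ergodic if every measurable set $E$ with $a(g)E=E$ for all $g$ has $\nu(E)\in\{0,1\}$. *)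

(* Defs.v *)
From HB Require Import structures.
From Stdlib Require Import ClassicalEpsilon.
From mathcomp Require Import all_boot all_order all_algebra.
From mathcomp Require Import all_classical all_reals all_analysis.
From mathcomp Require Import complex.

Set Implicit Arguments.
Unset Strict Implicit.
Unset Printing Implicit Defensive.

Import Order.TTheory GRing.Theory Num.Theory.
Local Open Scope classical_set_scope.
Local Open Scope ring_scope.

Section Kazhdan.
Context {R : realType}.
Local Notation C := R[i].

Definition hnorm {H : lmodType C} (ip : H -> H -> C) (v : H) : R :=
  Num.sqrt (complex.Re (ip v v)).

Definition inner_product {H : lmodType C} (ip : H -> H -> C) : Prop :=
  [/\ forall (a : C) (u v w : H), ip (a *: u + v) w = a * ip u w + ip v w,
      forall u v : H, ip u v = (ip v u)^*,
      forall u : H, 0 <= ip u u &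
      forall u : H, ip u u = 0 -> u = 0].

Definition ip_complete {H : lmodType C} (ip : H -> H -> C) : Prop :=
  forall u : nat -> H,
    (forall e : R, 0 < e -> exists N : nat, forall m n : nat,
        (N <= m)%N -> (N <= n)%N -> hnorm ip (u m - u n) < e) ->
    exists v : H, forall e : R, 0 < e -> exists N : nat, forall n : nat,
        (N <= n)%N -> hnorm ip (u n - v) < e.

Definition hilbert_space {H : lmodType C} (ip : H -> H -> C) : Prop :=
  inner_product ip /\ ip_complete ip.

Definition unitary_rep (G : groupType) {H : lmodType C} (ip : H -> H -> C)
    (pi : G -> H -> H) : Prop :=
  [/\ forall (g : G) (a : C) (u v : H), pi g (a *: u + v) = a *: pi g u + pi g v,
      forall (g : G) (u v : H), ip (pi g u) (pi g v) = ip u v,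
      forall (g : G) (w : H), exists u : H, pi g u = w,
      forall u : H, pi 1%g u = u &
      forall (g h : G) (u : H), pi (g * h)%g u = pi g (pi h u)].

Definition almost_invariant_vectors (G : groupType) {H : lmodType C}
    (ip : H -> H -> C) (pi : G -> H -> H) : Prop :=
  forall (Q : seq G) (e : R), 0 < e ->
    exists v : H, hnorm ip v = 1 /\
      forall g : G, g \in Q -> hnorm ip (pi g v - v) < e.

Definition property_T (G : groupType) : Prop :=
  forall (H : lmodType C) (ip : H -> H -> C) (pi : G -> H -> H),
    hilbert_space ip -> unitary_rep ip pi -> almost_invariant_vectors ip pi ->
    exists v : H, v <> 0 /\ forall g : G, pi g v = v.

End Kazhdan.

Section GroupMeasures.
Context {R : realType} {G : groupType}.

Definition probability_on (mu : G -> R) : Prop :=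
  (forall g : G, 0 <= mu g) /\ (\esum_(g in [set: G]) (mu g)%:E = 1)%E.

Definition generating (mu : G -> R) : Prop :=
  forall g : G, exists s : seq G,
    [/\ s <> [::], all (fun h => 0 < mu h) s &
        g = foldr (fun h k => (h * k)%g) 1%g s].

End GroupMeasures.

Section Actions.
Context {R : realType} {d : measure_display} {X : measurableType d}
  (nu : probability X R).

Definition standard_nonatomic : Prop :=
  exists (f : X -> R) (g : R -> X),
    [/\ measurable_fun [set: X] f, measurable_fun [set: R] g,
        forall B : set R, measurable B ->
          nu (f @^-1` B) = (@lebesgue_measure R) (B `&` `[0%R, 1%R]%classic),
        {ae nu, forall x, g (f x) = x} &
        {ae (@lebesgue_measure R), forall y, `[0%R, 1%R]%classic y -> f (g y) = y}].

(* representatives of elements of Aut^*(X, nu) *)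
Definition nonsingular (T : X -> X) : Prop :=
  measurable_fun [set: X] T /\
  forall B : set X, measurable B -> (nu (T @^-1` B) = 0%E <-> nu B = 0%E).

Variable G : groupType.

Definition nonsingular_action (a : G -> X -> X) : Prop :=
  [/\ forall g : G, nonsingular (a g),
      forall g h : G, {ae nu, forall x, a (g * h)%g x = a g (a h x)} &
      {ae nu, forall x, a 1%g x = x}].

Definition stationary (mu : G -> R) (a : G -> X -> X) : Prop :=
  forall B : set X, measurable B ->
    (\esum_(g in [set: G]) ((mu g)%:E * nu (a g @^-1` B)) = nu B)%E.

Definition A_mu (mu : G -> R) : set (G -> X -> X) :=
  [set a | nonsingular_action a /\ stationary mu a].

Definition ergodic (a : G -> X -> X) : Prop :=
  forall E : set X, measurable E ->
    (forall g : G, nu ((a g @^-1` E) `\` E) = 0%E /\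
                   nu (E `\` (a g @^-1` E)) = 0%E) ->
    nu E = 0%E \/ nu E = 1%E.

Definition is_RN_density (T : X -> X) (f : X -> R) : Prop :=
  [/\ measurable_fun [set: X] f, forall x, 0 <= f x &
      forall B : set X, measurable B ->
        nu (T @^-1` B) = (\int[nu]_(x in B) (f x)%:E)%E].

Definition RN_density (T : X -> X) : X -> R :=
  epsilon (inhabits (fun _ : X => 0)) (is_RN_density T).

(* U_{T,1} 1_A = d(T_* nu)/d nu * 1_A o T^{-1}; Tinv is the inverse of T *)
Definition U1 (T Tinv : X -> X) (A : set X) : X -> R :=
  fun x => RN_density T x * \1_A (Tinv x).

Definition L1dist (f h : X -> R) : \bar R :=
  (\int[nu]_x (`|f x - h x|)%:E)%E.

(* basic neighbourhood of a in the topology of pointwise convergence for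
   the weak topology: finitely many group elements F, finitely many
   measurable sets As 0, ..., As (n-1), and a radius e *)
Definition weak_nbhd (a : G -> X -> X) (F : seq G) (n : nat)
    (As : nat -> set X) (e : R) : set (G -> X -> X) :=
  [set b | forall (g : G) (i : nat), g \in F -> (i < n)%N -> measurable (As i) ->
     (L1dist (U1 (b g) (b g^-1%g) (As i)) (U1 (a g) (a g^-1%g) (As i)) < e%:E)%E].

Definition closure_in (S E : set (G -> X -> X)) : set (G -> X -> X) :=
  [set a | S a /\ forall F n As e, 0 < e ->
     exists b, [/\ S b, E b & weak_nbhd a F n As e b]].

Definition nowhere_dense_in (S E : set (G -> X -> X)) : Prop :=
  ~ exists a F n As e, [/\ 0 < e, S a &
      forall b, S b -> weak_nbhd a F n As e b -> closure_in S E b].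

End Actions.

(* Main.v *)
Require Import Defs.
From Stdlib Require ClassicalEpsilon.
From HB Require Import structures.
From mathcomp Require Import all_boot all_order all_algebra.
From mathcomp Require Import all_classical all_reals all_analysis.
From mathcomp Require Import complex.
From mathcomp Require Import measurable_realfun ring lra.

(**
  Let [a] be a stationary action. Shrink it by a dilation of the standard space
  onto a subset [X0] of measure [s < 1] and let [G] act trivially on the
  complement [Z]: the glued action [b] is again stationary, and it tends to [a]
  as [s] tends to 1. It remains to see that [b] is not a limit of ergodic
  stationary actions [c_k].

  As [b] fixes [Z] pointwise, the vectors [1_Z] are asymptotically invariant
  for the Koopman representations [f |-> sqrt(d c_k(g)_* nu / d nu) f o c_k(g)^-1]
  on [L2(X, nu)]. Replace [1_Z] by [1_Z - nu(Z)] in the space of functions of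
  integral 0 for those [k] for which [c_k] preserves [nu], and apply property (T)
  to the direct sum over [k]: some [c_k] has a nonzero invariant vector [xi],
  with [\int xi = 0] if [c_k] preserves [nu].

  Then [xi^2 nu] is a [c_k]-invariant measure. The sublevel set [P = {xi^2 < t}]
  has the largest [nu]-measure among the sets of the same [xi^2 nu]-measure, in
  particular [nu(c_k(g)^-1 P) <= nu(P)]. By stationarity these are equalities for
  [g] in the support of [mu], which makes [P] invariant. Ergodicity now forces
  [xi^2] to be constant, so [c_k] preserves [nu], [xi] itself is constant, and
  [\int xi <> 0], a contradiction.
*)

Set Implicit Arguments.
Unset Strict Implicit.
Unset Printing Implicit Defensive.

Import Order.TTheory GRing.Theory Num.Theory.
Import numFieldNormedType.Exports.
Local Open Scope classical_set_scope.
Local Open Scope ring_scope.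

(** * Property (T) for real spaces with a degenerate inner product *)

Section SemiInnerProduct.
Context {R : realType} {V : lmodType R}.
Implicit Types (ip : V -> V -> R) (N : set V).

(** [property_T] supplies one nonzero invariant vector and no Kazhdan constant, so a sequence of
    different representations with ever better almost invariant vectors must first become a single
    representation: hence the direct sum. Nothing controls the layer [k] on which the invariant
    vector is nonzero, and any [k] will do, since every [c_k] is ergodic and stationary. Where [c_k]
    preserves [nu], the constants are invariant and would be a useless answer; only there are they
    removed, since elsewhere their orthogonal complement need not be a subrepresentation. The weak
    topology lives on L1 and the representation on L2; the bridge is |sqrt u - sqrt v|^2 <= |u - v|.
    Maps are given by representatives, so the group law holds only almost everywhere, and functions
    are real: the working setting is a real space with a degenerate form, and a complex Hilbert
    space is built from it only to apply [property_T]. *)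

Definition semi_ip ip : Prop :=
  [/\ forall (a : R) (u v w : V), ip (a *: u + v) w = a * ip u w + ip v w,
      forall u v, ip u v = ip v u & forall u, 0 <= ip u u].

Definition semi_complete ip : Prop :=
  forall u : nat -> V,
    (forall e : R, 0 < e -> exists N : nat, forall m n : nat,
        (N <= m)%N -> (N <= n)%N -> ip (u m - u n) (u m - u n) < e) ->
    exists v : V, forall e : R, 0 < e -> exists N : nat, forall n : nat,
        (N <= n)%N -> ip (u n - v) (u n - v) < e.

(** In the application [N] consists of the constants on the layers whose action preserves [nu]. *)
Definition orthogonal_to ip N : set V := [set v | forall e, N e -> ip v e = 0].

Section Theory.
Context (ip : V -> V -> R) (ipP : semi_ip ip).

Lemma semi_ipC u v : ip u v = ip v u. Proof. by case: ipP. Qed.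

Lemma semi_ip_ge0 u : 0 <= ip u u. Proof. by case: ipP. Qed.

Lemma semi_ipPl a u v w : ip (a *: u + v) w = a * ip u w + ip v w.
Proof. by case: ipP. Qed.

Lemma semi_ip0l w : ip 0 w = 0.
Proof.
by have := semi_ipPl 1 0 0 w; rewrite scaler0 addr0 mul1r => h; lra.
Qed.

Lemma semi_ipDl u v w : ip (u + v) w = ip u w + ip v w.
Proof. by have := semi_ipPl 1 u v w; rewrite scale1r mul1r. Qed.

Lemma semi_ipZl a u w : ip (a *: u) w = a * ip u w.
Proof. by have := semi_ipPl a u 0 w; rewrite addr0 semi_ip0l addr0. Qed.

Lemma semi_ipNl u w : ip (- u) w = - ip u w.
Proof. by rewrite -scaleN1r semi_ipZl mulN1r. Qed.

Lemma semi_ipBl u v w : ip (u - v) w = ip u w - ip v w.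
Proof. by rewrite semi_ipDl semi_ipNl. Qed.

Lemma semi_ipDr u v w : ip w (u + v) = ip w u + ip w v.
Proof. by rewrite !(semi_ipC w) semi_ipDl. Qed.

Lemma semi_ipZr a u w : ip w (a *: u) = a * ip w u.
Proof. by rewrite !(semi_ipC w) semi_ipZl. Qed.

Lemma semi_ip_CauchySchwarz u v : ip u v ^+ 2 <= ip u u * ip v v.
Proof.
have h t : 0 <= ip u u + 2 * t * ip u v + t ^+ 2 * ip v v.
  have := semi_ip_ge0 (u + t *: v).
  rewrite semi_ipDl !semi_ipDr !semi_ipZl !semi_ipZr (semi_ipC v u).
  by move=> h; nra.
have [v0|v0] := eqVneq (ip v v) 0.
  have [->|uv] := eqVneq (ip u v) 0; first by rewrite v0 mulr0 expr0n.
  (* For [ip v v = 0] the expression is affine in [t]; this [t] gives it the value -1. *)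
  have := h (- (ip u u + 1) / (2 * ip u v)).
  rewrite v0 mulr0 addr0.
  have -> : 2 * (- (ip u u + 1) / (2 * ip u v)) * ip u v = - (ip u u + 1).
    by field.
  by move=> ?; lra.
have v1 : 0 < ip v v by rewrite lt_def v0 semi_ip_ge0.
(* The minimum of the quadratic in [t]. *)
have := h (- ip u v / ip v v).
have -> : ip u u + 2 * (- ip u v / ip v v) * ip u v +
    (- ip u v / ip v v) ^+ 2 * ip v v = (ip u u * ip v v - ip u v ^+ 2) / ip v v.
  by field.
by rewrite pmulr_lge0 ?invr_gt0// subr_ge0.
Qed.

Lemma semi_ip_null u w : ip u u = 0 -> ip u w = 0.
Proof.
move=> u0; have := semi_ip_CauchySchwarz u w; rewrite u0 mul0r => h.
by apply/eqP; rewrite -sqrf_eq0 eq_le h sqr_ge0.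
Qed.

Lemma semi_ip_isometry (A : V -> V) :
  (forall u v, A (u + v) = A u + A v) -> (forall u, ip (A u) (A u) = ip u u) ->
  forall u v, ip (A u) (A v) = ip u v.
Proof.
move=> AD AI u v; have := AI (u + v).
rewrite AD !semi_ipDl !semi_ipDr !AI (semi_ipC (A v)) (semi_ipC v u) => h; lra.
Qed.

Lemma orthogonal_to0 N : orthogonal_to ip N 0.
Proof. by move=> e _; rewrite semi_ip0l. Qed.

Lemma orthogonal_toPl N a u v : orthogonal_to ip N u -> orthogonal_to ip N v ->
  orthogonal_to ip N (a *: u + v).
Proof. by move=> hu hv e Ne; rewrite semi_ipPl hu// hv// mulr0 addr0. Qed.

Lemma orthogonal_toZ N a u : orthogonal_to ip N u ->
  orthogonal_to ip N (a *: u).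
Proof. by move=> hu e Ne; rewrite semi_ipZl hu// mulr0. Qed.

Lemma orthogonal_to_limit N (u : nat -> V) v :
  (forall n, orthogonal_to ip N (u n)) ->
  (forall e : R, 0 < e -> exists N : nat, forall n : nat,
        (N <= n)%N -> ip (u n - v) (u n - v) < e) ->
  orthogonal_to ip N v.
Proof.
move=> uN uv w Nw; apply/eqP; apply: contraT => vw.
have vw2 : 0 < ip v w ^+ 2 by rewrite lt_def sqrf_eq0 vw sqr_ge0.
have w0 := semi_ip_ge0 w.
(* The summand 1 keeps the denominator positive when [w] is a null vector. *)
have [|n /(_ n (leqnn _)) hn] := uv (ip v w ^+ 2 / (ip w w + 1)).
  by rewrite divr_gt0//; lra.
have := semi_ip_CauchySchwarz (u n - v) w.
rewrite semi_ipBl uN// sub0r sqrrN => h.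
have : ip v w ^+ 2 < ip v w ^+ 2 / (ip w w + 1) * (ip w w + 1).
  apply: (le_lt_trans h); apply: (@le_lt_trans _ _ (ip v w ^+ 2 / (ip w w + 1) * ip w w)).
    by rewrite ler_wpM2r// ltW.
  by rewrite ltr_pM2l ?divr_gt0//; lra.
by rewrite divfK ?ltxx//; apply/eqP; lra.
Qed.

End Theory.
End SemiInnerProduct.

(* The quotient of the complexification of [N^perp] by null vectors, realised
   inside [V -> C] by sending [v1 + i v2] to [w |-> <v1, w> + i <v2, w>]. *)
Section Complexification.
Context {R : realType} {V : lmodType R} (ip : V -> V -> R) (N : set V).
Local Notation C := R[i].

Definition riesz (v1 v2 : V) : V -> C^o :=
  fun w => Complex (ip v1 w) (ip v2 w).

Definition riesz_range : {pred V -> C^o} :=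
  fun F => `[< exists v1 v2, [/\ orthogonal_to ip N v1, orthogonal_to ip N v2 &
                              F = riesz v1 v2] >].

(** Indexing the type by [ipP] lets the module structure below, whose closure properties rest on
    [ipP], be attached to it. *)
Definition separated (ipP : semi_ip ip) := {F | F \in riesz_range}.
Context (ipP : semi_ip ip).
HB.instance Definition _ := SubChoice.on (separated ipP).

Lemma riesz_scaleD (c : C) v1 v2 u1 u2 :
  c *: riesz v1 v2 + riesz u1 u2 =
  riesz ((complex.Re c) *: v1 + ((- complex.Im c) *: v2 + u1))
        ((complex.Re c) *: v2 + ((complex.Im c) *: v1 + u2)).
Proof.
apply/funext => w; case: c => a b /=.
rewrite /riesz /= !(semi_ipPl ipP).
apply/eqP; rewrite eq_complex /=; apply/andP; split; apply/eqP.
  rewrite -[X in X + _ = _]/(a * ip v1 w - b * ip v2 w); ring.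
rewrite -[X in X + _ = _]/(a * ip v2 w + b * ip v1 w); ring.
Qed.

Lemma riesz_range_submod_closed : submod_closed riesz_range.
Proof.
split.
  apply/asboolP; exists 0, 0; split; [exact: orthogonal_to0..|].
  by apply/funext => w; rewrite /riesz !(semi_ip0l ipP).
move=> c F1 F2 /asboolP[v1 [v2 [k1 k2 ->]]] /asboolP[u1 [u2 [l1 l2 ->]]].
apply/asboolP; rewrite riesz_scaleD.
by do 2 eexists; split; [| |reflexivity]; do 2 apply: orthogonal_toPl => //.
Qed.

HB.instance Definition _ := GRing.isSubmodClosed.Build _ _ riesz_range
  riesz_range_submod_closed.
HB.instance Definition _ := [SubChoice_isSubLmodule of separated ipP by <:].

Local Notation H := (separated ipP).

Lemma val_scaleD (c : C) (F E : H) :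
  val (c *: F + E) = c *: val F + val E.
Proof. by []. Qed.

Lemma val_sub (F E : H) : val (F - E) = val F - val E.
Proof. by []. Qed.

Lemma separatedP (F : H) : {v : V * V |
  [/\ orthogonal_to ip N v.1, orthogonal_to ip N v.2 & val F = riesz v.1 v.2]}.
Proof.
by apply/cid; have /asboolP[v1 [v2 [? ? ?]]] := valP F; exists (v1, v2).
Qed.

(** Chosen real and imaginary parts of a representative. [F] determines them only up to null
    vectors, and the choice gives no linearity. *)
Definition lift1 (F : H) : V := (sval (separatedP F)).1.
Definition lift2 (F : H) : V := (sval (separatedP F)).2.

Lemma orthogonal_lift1 F : orthogonal_to ip N (lift1 F).
Proof. by rewrite /lift1; case: separatedP => ? []. Qed.

Lemma orthogonal_lift2 F : orthogonal_to ip N (lift2 F).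
Proof. by rewrite /lift2; case: separatedP => ? []. Qed.

Lemma riesz_lift F : val F = riesz (lift1 F) (lift2 F).
Proof. by rewrite /lift1 /lift2; case: separatedP => ? []. Qed.

Lemma riesz_rangeP v1 v2 : orthogonal_to ip N v1 -> orthogonal_to ip N v2 ->
  riesz v1 v2 \in riesz_range.
Proof. by move=> h1 h2; apply/asboolP; exists v1, v2. Qed.

Definition separate v1 v2 (h1 : orthogonal_to ip N v1)
  (h2 : orthogonal_to ip N v2) : H :=
  exist (fun F => F \in riesz_range) (riesz v1 v2) (riesz_rangeP h1 h2).

Lemma riesz_inj v1 v2 u1 u2 : riesz v1 v2 = riesz u1 u2 ->
  ip v1 =1 ip u1 /\ ip v2 =1 ip u2.
Proof. by move=> h; split => w; have := congr1 (@^~ w) h => -[]. Qed.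

(** The expansion of <v1 + i v2, u1 + i u2>, linear in the first argument and conjugate linear in
    the second. *)
Definition separated_ip (F E : H) : C :=
  Complex (ip (lift1 F) (lift1 E) + ip (lift2 F) (lift2 E))
          (ip (lift2 F) (lift1 E) - ip (lift1 F) (lift2 E)).

(** Well-definedness: any representatives may replace the chosen ones, so that computations can use
    representatives that are linear in the data. *)
Lemma separated_ipE F E v1 v2 u1 u2 :
  val F = riesz v1 v2 -> val E = riesz u1 u2 ->
  separated_ip F E = Complex (ip v1 u1 + ip v2 u2) (ip v2 u1 - ip v1 u2).
Proof.
rewrite !riesz_lift => /riesz_inj[h1 h2] /riesz_inj[k1 k2].
rewrite /separated_ip !h1 !h2 ![ip _ (lift1 E)](semi_ipC ipP).
by rewrite ![ip _ (lift2 E)](semi_ipC ipP) !k1 !k2 !(semi_ipC ipP u1, semi_ipC ipP u2).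
Qed.

Lemma separated_inner_product : inner_product separated_ip.
Proof.
split.
- move=> c F E K.
  have := riesz_scaleD c (lift1 F) (lift2 F) (lift1 E) (lift2 E).
  rewrite -!riesz_lift => hFE.
  rewrite (@separated_ipE (c *: F + E) K _ _ _ _ hFE (riesz_lift K)).
  rewrite /separated_ip; case: c {hFE} => a b /=.
  rewrite !(semi_ipPl ipP); apply/eqP; rewrite eq_complex /=.
  by apply/andP; split; apply/eqP; ring.
- move=> F E; rewrite /separated_ip.
  rewrite -[RHS]/(conjc _) /=.
  by congr Complex; rewrite ?opprB !(semi_ipC ipP _ (lift1 F)) !(semi_ipC ipP _ (lift2 F)).
- move=> F; rewrite lecE /= (semi_ipC ipP (lift2 F)) subrr eqxx /=.
  by rewrite addr_ge0// semi_ip_ge0.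
- move=> F /(congr1 (@complex.Re R)).
  rewrite -[complex.Re (separated_ip F F)]/(ip _ _ + ip _ _) => /eqP.
  rewrite -[complex.Re 0]/(0 : R) paddr_eq0 ?(semi_ip_ge0 ipP)//.
  move=> /andP[/eqP h1 /eqP h2]; apply/val_inj; rewrite riesz_lift.
  by apply/funext => w; rewrite /riesz (semi_ip_null ipP w h1) (semi_ip_null ipP w h2).
Qed.

Lemma separated_normE F v1 v2 : val F = riesz v1 v2 ->
  hnorm separated_ip F = Num.sqrt (ip v1 v1 + ip v2 v2).
Proof. by move=> h; rewrite /hnorm (separated_ipE h h). Qed.

Lemma riesz_sub v1 v2 u1 u2 :
  riesz v1 v2 - riesz u1 u2 = riesz (v1 - u1) (v2 - u2).
Proof.
by apply/funext => w; rewrite /riesz !(semi_ipBl ipP).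
Qed.

Lemma separated_complete : semi_complete ip -> ip_complete separated_ip.
Proof.
move=> cV u cu.
have normB m n : hnorm separated_ip (u m - u n) =
    Num.sqrt (ip (lift1 (u m) - lift1 (u n)) (lift1 (u m) - lift1 (u n)) +
              ip (lift2 (u m) - lift2 (u n)) (lift2 (u m) - lift2 (u n))).
  apply: separated_normE; rewrite val_sub !riesz_lift.
  exact: riesz_sub.
have cauchy e : 0 < e -> exists N : nat, forall m n : nat,
        (N <= m)%N -> (N <= n)%N ->
    ip (lift1 (u m) - lift1 (u n)) (lift1 (u m) - lift1 (u n)) +
    ip (lift2 (u m) - lift2 (u n)) (lift2 (u m) - lift2 (u n)) < e.
  move=> e0; have [|M hM] := cu (Num.sqrt e); first by rewrite sqrtr_gt0.
  by exists M => m n hm hn; have := hM _ _ hm hn; rewrite normB ltr_sqrt.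
have ge0 := semi_ip_ge0 ipP.
have [|v1 hv1] := cV (fun n => lift1 (u n)).
  move=> e /cauchy[M hM]; exists M => m n hm hn.
  by apply: le_lt_trans (hM _ _ hm hn); rewrite lerDl.
have [|v2 hv2] := cV (fun n => lift2 (u n)).
  move=> e /cauchy[M hM]; exists M => m n hm hn.
  by apply: le_lt_trans (hM _ _ hm hn); rewrite lerDr.
have k1 : orthogonal_to ip N v1.
  by apply: (orthogonal_to_limit ipP _ hv1) => n; exact: orthogonal_lift1.
have k2 : orthogonal_to ip N v2.
  by apply: (orthogonal_to_limit ipP _ hv2) => n; exact: orthogonal_lift2.
exists (separate k1 k2) => e e0.
(* The squared norm is the sum of two parts, each below half of [e ^+ 2]. *)
have e2 : 0 < e ^+ 2 / 2 by rewrite divr_gt0// exprn_gt0.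
have [M1 hM1] := hv1 _ e2; have [M2 hM2] := hv2 _ e2.
exists (maxn M1 M2) => n; rewrite geq_max => /andP[/hM1 h1 /hM2 h2].
rewrite (@separated_normE _ (lift1 (u n) - v1) (lift2 (u n) - v2)); last first.
  by rewrite val_sub riesz_lift riesz_sub.
have -> : e = Num.sqrt (e ^+ 2) by rewrite sqrtr_sqr ger0_norm// ltW.
by rewrite ltr_sqrt ?exprn_gt0//; lra.
Qed.

End Complexification.

(** The unit and product laws hold up to null vectors, as they do for Koopman operators of maps that
    compose only almost everywhere. *)
Definition almost_orthogonal_rep {R : realType} {G : groupType} {V : lmodType R}
    (ip : V -> V -> R) (pi : G -> V -> V) : Prop :=
  [/\ forall (g : G) (a : R) (u v : V), pi g (a *: u + v) = a *: pi g u + pi g v,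
      forall (g : G) (u : V), ip (pi g u) (pi g u) = ip u u,
      forall u : V, ip (pi 1%g u - u) (pi 1%g u - u) = 0 &
      forall (g h : G) (u : V),
        ip (pi (g * h)%g u - pi g (pi h u)) (pi (g * h)%g u - pi g (pi h u)) = 0].

(** On the separated complexification of the complement of [N], the maps [pi g] induce a genuine
    unitary representation. A nonzero invariant vector there has a real or an imaginary part that is
    not null, and this part is invariant up to null vectors. *)
Lemma property_T_semi {R : realType} (G : groupType) (V : lmodType R)
    (ip : V -> V -> R) (pi : G -> V -> V) (N : set V) :
  property_T (R := R) G -> semi_ip ip -> semi_complete ip ->
  almost_orthogonal_rep ip pi ->
  (forall g u, orthogonal_to ip N u -> orthogonal_to ip N (pi g u)) ->
  (forall (Q : seq G) (e : R), 0 < e -> exists v : V,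
     [/\ orthogonal_to ip N v, 0 < ip v v &
      forall g, g \in Q -> ip (pi g v - v) (pi g v - v) < e * ip v v]) ->
  exists v : V, [/\ orthogonal_to ip N v, 0 < ip v v &
    forall g, ip (pi g v - v) (pi g v - v) = 0].
Proof.
move=> TG ipP cV [piL piI pi1 piM] piN almost.
pose H : lmodType R[i] := separated N ipP.
pose hip := @separated_ip _ _ ip N ipP.
(* Defined through the chosen lifts; [rhoE] below frees it from the choice, because isometries send
   null vectors to null vectors. *)
pose rho g (F : H) : H := separate ipP (piN g _ (orthogonal_lift1 F))
   (piN g _ (orthogonal_lift2 F)).
have null_eq u v : ip (u - v) (u - v) = 0 -> ip u =1 ip v.
  move=> h w; have := semi_ip_null ipP w h.
  by rewrite (semi_ipBl ipP) => /eqP; rewrite subr_eq0 => /eqP.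
have eq_null u v : ip u =1 ip v -> ip (u - v) (u - v) = 0.
  by move=> h; rewrite (semi_ipBl ipP) h subrr.
have piB g u v : pi g (u - v) = pi g u - pi g v.
  by rewrite addrC -scaleN1r piL scaleN1r addrC.
have pi_null g u v : ip u =1 ip v -> ip (pi g u) =1 ip (pi g v).
  by move=> /eq_null h; apply: null_eq; rewrite -piB piI.
have piIip g u v : ip (pi g u) (pi g v) = ip u v.
  apply: (semi_ip_isometry ipP) => // x y.
  by have := piL g 1 x y; rewrite !scale1r.
have rhoE g F v1 v2 : val F = riesz ip v1 v2 ->
    val (rho g F) = riesz ip (pi g v1) (pi g v2).
  rewrite riesz_lift => /riesz_inj[h1 h2].
  by apply/funext => w /=; rewrite /riesz (pi_null g _ _ h1) (pi_null g _ _ h2).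
have [|||F [F0 Finv]] := TG H hip rho.
- by split; [exact: separated_inner_product|exact: separated_complete].
- split.
  + move=> g c F E; apply/val_inj.
    have := riesz_scaleD ipP c (lift1 F) (lift2 F) (lift1 E) (lift2 E).
    rewrite -!riesz_lift => hFE; rewrite (rhoE _ (c *: F + E) _ _ hFE).
    rewrite val_scaleD (rhoE _ _ _ _ (riesz_lift F)) (rhoE _ _ _ _ (riesz_lift E)).
    by rewrite (riesz_scaleD ipP) !piL.
  + move=> g F E; rewrite /hip (separated_ipE (rhoE g _ _ _ (riesz_lift F))
      (rhoE g _ _ _ (riesz_lift E))).
    by rewrite (separated_ipE (riesz_lift F) (riesz_lift E)) !piIip.
  + move=> g F; exists (rho g^-1%g F); apply/val_inj.
    rewrite (rhoE _ _ _ _ (rhoE _ _ _ _ (riesz_lift F))) (riesz_lift F).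
    apply/funext => w; rewrite /riesz.
    by rewrite -!(null_eq _ _ (piM _ _ _)) !mulgV !(null_eq _ _ (pi1 _)).
  + move=> F; apply/val_inj; rewrite (rhoE _ _ _ _ (riesz_lift F)) (riesz_lift F).
    by apply/funext => w; rewrite /riesz !(null_eq _ _ (pi1 _)).
  + move=> g h F; apply/val_inj.
    rewrite (rhoE _ _ _ _ (rhoE _ _ _ _ (riesz_lift F))) (rhoE _ _ _ _ (riesz_lift F)).
    by apply/funext => w; rewrite /riesz !(null_eq _ _ (piM _ _ _)).
(* [ip] gives squared norms, hence [e ^+ 2]. The real vector [v], scaled to norm 1 and with
   imaginary part 0, is the required almost invariant vector. *)
- move=> Q e e0; have [|v [Kv v0 hv]] := almost Q (e ^+ 2).
    by rewrite exprn_gt0.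
  pose c := (Num.sqrt (ip v v))^-1.
  have c2 : c ^+ 2 * ip v v = 1.
    by rewrite exprVn sqr_sqrtr ?(ltW v0)// mulVf ?gt_eqF.
  pose E : H := separate ipP (orthogonal_toZ ipP c Kv) (@orthogonal_to0 _ _ _ ipP N).
  exists E; split.
    rewrite (@separated_normE _ _ _ _ _ E (c *: v) 0)//.
    by rewrite (semi_ipZl ipP) (semi_ipZr ipP) (semi_ip0l ipP) mulrA -expr2 c2 addr0 sqrtr1.
  move=> g gQ.
  have pi0 : pi g 0 = 0 by have := piB g 0 0; rewrite !subrr.
  have piZ : pi g (c *: v) = c *: pi g v by have := piL g c v 0; rewrite pi0 !addr0.
  rewrite (@separated_normE _ _ _ _ _ (rho g E - E) (c *: (pi g v - v)) 0); last first.
    rewrite val_sub (rhoE g E (c *: v) 0)//.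
    by rewrite (riesz_sub ipP) piZ pi0 subrr scalerBr.
  rewrite (semi_ipZl ipP) (semi_ipZr ipP) (semi_ip0l ipP) mulrA -expr2 addr0.
  have -> : e = Num.sqrt (e ^+ 2) by rewrite sqrtr_sqr ger0_norm// ltW.
  rewrite ltr_sqrt ?exprn_gt0//.
  have c0 : 0 < c ^+ 2 by rewrite exprn_gt0// invr_gt0 sqrtr_gt0.
  have := hv g gQ; rewrite -(ltr_pM2l c0) => /lt_le_trans; apply.
  by rewrite mulrCA c2 mulr1.
have inv1 g : ip (pi g (lift1 F) - lift1 F) (pi g (lift1 F) - lift1 F) = 0.
  apply: eq_null; have := congr1 val (Finv g).
  by rewrite (rhoE g _ _ _ (riesz_lift F)) riesz_lift => /riesz_inj[].
have inv2 g : ip (pi g (lift2 F) - lift2 F) (pi g (lift2 F) - lift2 F) = 0.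
  apply: eq_null; have := congr1 val (Finv g).
  by rewrite (rhoE g _ _ _ (riesz_lift F)) riesz_lift => /riesz_inj[].
have [h1|h1] := eqVneq (ip (lift1 F) (lift1 F)) 0; last first.
  by exists (lift1 F); split => //; [exact: orthogonal_lift1|rewrite lt_def h1 semi_ip_ge0].
have [h2|h2] := eqVneq (ip (lift2 F) (lift2 F)) 0; last first.
  by exists (lift2 F); split => //; [exact: orthogonal_lift2|rewrite lt_def h2 semi_ip_ge0].
exfalso; apply: F0; apply/val_inj; rewrite riesz_lift; apply/funext => w.
by rewrite /riesz (semi_ip_null ipP w h1) (semi_ip_null ipP w h2).
Qed.

(** * Completeness of [L2] *)

Section L2.
Context {R : realType} {d : measure_display} {T : measurableType d}
  (m : {measure set T -> \bar R}).
Local Notation L2 := (LfunType m (lee1n 2)).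

Lemma L2P (f : T -> R) : f \in Lfun m 2%:E <->
  measurable_fun setT f /\ (\int[m]_x (f x ^+ 2)%:E < +oo)%E.
Proof.
split=> [fL|[mf fi]].
  split; first by have /andP[/[!inE]] := fL.
  have /integrableP[_] := Lfun2_integrable_sqr fL.
  by under eq_integral do rewrite gee0_abs ?lee_fin ?sqr_ge0//.
rewrite inE; apply/andP; split; rewrite inE//= /finite_norm unlock /=.
apply: poweR_lty; apply: le_lt_trans fi.
rewrite le_eqVlt; apply/orP; left; apply/eqP; apply: eq_integral => x _ /=.
by rewrite powR_mulrn// -normrX ger0_norm ?sqr_ge0.
Qed.

Lemma L2_measurable (f : L2) : measurable_fun setT f.
Proof. exact: measurable_funP. Qed.

Lemma L2_integrableM (f g : L2) :
  m.-integrable setT (fun x => (f x * g x)%:E).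
Proof.
have /Lfun1_integrable := @Lfun2_mul_Lfun1 _ _ _ m _ _ (LfunP f) (LfunP g).
by [].
Qed.

Definition L2ip (f g : L2) : R := Rintegral m setT (fun x => f x * g x).

Lemma L2ipE (f g : L2) : (L2ip f g)%:E = (\int[m]_x (f x * g x)%:E)%E.
Proof.
by rewrite /L2ip /Rintegral fineK//; apply: integrable_fin_num; rewrite ?L2_integrableM.
Qed.

Lemma L2ip_sqr (f : L2) : (L2ip f f)%:E = (\int[m]_x (f x ^+ 2)%:E)%E.
Proof. by rewrite L2ipE; apply: eq_integral => x _; rewrite expr2. Qed.

Lemma L2ip_semi : semi_ip L2ip.
Proof.
split.
- move=> a u v w; rewrite /L2ip.
  transitivity (Rintegral m setT (fun x => a * (u x * w x) + v x * w x)).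
    by apply: eq_Rintegral => x _; rewrite -[(a *: u + v) x]/(a * u x + v x); ring.
  rewrite RintegralD//; last 2 first.
  - exact: (integrableZl measurableT a (L2_integrableM u w)).
  - exact: L2_integrableM.
  by rewrite RintegralZl// L2_integrableM.
- by move=> u v; apply: eq_Rintegral => x _; rewrite mulrC.
- by move=> u; rewrite -lee_fin L2ip_sqr integral_ge0// => x _; rewrite lee_fin sqr_ge0.
Qed.

Lemma sum_geo_half n : \sum_(0 <= k < n) (2^-1 : R) ^+ k = 2 - 2 * 2^-1 ^+ n.
Proof.
elim: n => [|n IH]; first by rewrite big_geq// expr0; lra.
by rewrite big_nat_recr//= IH exprS; field.
Qed.

Lemma sum_geo_half_le n : \sum_(0 <= k < n) (2^-1 : R) ^+ k <= 2.
Proof. by rewrite sum_geo_half lerBlDr lerDl mulr_ge0// exprn_ge0// invr_ge0. Qed.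

(** Since |a| <= 2^k a^2 + 2^-k, the increments are absolutely summable, with sum at most
    [M + 2]. *)
Lemma cvg_weighted_sqr_increments (w : nat -> R) (M : R) :
  (forall n, \sum_(0 <= k < n) 2 ^+ k * (w k.+1 - w k) ^+ 2 <= M) -> cvgn w.
Proof.
move=> hM.
have cvgs : cvgn (series (fun k => w k.+1 - w k)).
  apply: normed_cvg; apply: nondecreasing_is_cvgn.
    by apply: nondecreasing_series => k _ _; exact: normr_ge0.
  exists (M + 2) => _ [n _ <-]; rewrite /series /=.
  apply: (@le_trans _ _ (\sum_(0 <= k < n) (2 ^+ k * (w k.+1 - w k) ^+ 2 + 2^-1 ^+ k))).
    apply: ler_sum => k _; rewrite exprVn.
    have c0 : 0 < (2 : R) ^+ k by rewrite exprn_gt0.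
    move: (2 ^+ k) c0 => c c0.
    have -> : c * (w k.+1 - w k) ^+ 2 + c^-1 = c^-1 * ((c * `|w k.+1 - w k|) ^+ 2 + 1).
      by rewrite -(real_normK (num_real (w k.+1 - w k))); field; rewrite gt_eqF.
    rewrite -[leLHS](mulKf (lt0r_neq0 c0)) ler_wpM2l ?invr_ge0 ?ltW//.
    by move: (c * _) => t; have := sqr_ge0 (t - 2^-1); nra.
  by rewrite big_split/= lerD// sum_geo_half_le.
have -> : w = (fun n => w 0%N + series (fun k => w k.+1 - w k) n).
  by apply/funext => n; rewrite /series /= telescope_sumr//; ring.
by apply: is_cvgD => //; exact: is_cvg_cst.
Qed.

(** The sum of 2^k (w_(k+1) - w_k)^2 has integral at most the sum of 2^k 4^-k, which is at most 2;
    it is therefore finite almost everywhere. *)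
Lemma ae_cvg_L2_increments (w : nat -> T -> R) :
  (forall n, measurable_fun setT (w n)) ->
  (forall n, \int[m]_x ((w n.+1 x - w n x) ^+ 2)%:E <= (4^-1 ^+ n)%:E)%E ->
  {ae m, forall x, cvgn (w ^~ x)}.
Proof.
move=> mw hw.
pose s k x := (2 ^+ k * (w k.+1 x - w k x) ^+ 2)%:E : \bar R.
have s0 k x : (0 <= s k x)%E by rewrite lee_fin mulr_ge0 ?sqr_ge0// exprn_ge0.
have mdw k : measurable_fun setT (EFin \o (fun x => (w k.+1 x - w k x) ^+ 2)).
  by apply/measurable_EFinP; apply: measurable_funX; exact: measurable_funB.
have ms k : measurable_fun setT (s k).
  apply/measurable_EFinP; apply: measurable_funM => //.
  exact/measurable_EFinP.
pose S x := (\sum_(0 <= k <oo) s k x)%E.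
have mS : measurable_fun setT S by apply: ge0_emeasurable_sum => // *.
have iS : (\int[m]_x S x <= 2%:E)%E.
  rewrite (integral_nneseries m measurableT ms (fun k x _ => s0 k x)).
  apply: lime_le.
    by apply: is_cvg_nneseries => *; apply: integral_ge0 => *; exact: s0.
  apply: nearW => n.
  apply: (@le_trans _ _ (\sum_(0 <= k < n) (2^-1 ^+ k)%:E)%E).
    apply: lee_sum => k _; rewrite /s.
    under eq_integral do rewrite EFinM.
    rewrite (ge0_integralZl m measurableT (mdw k)) ?lee_fin ?exprn_ge0//; last first.
      by move=> x _; rewrite lee_fin sqr_ge0.
    apply: (@le_trans _ _ ((2 ^+ k)%:E * (4^-1 ^+ k)%:E)%E).
      by apply: lee_wpmul2l; [rewrite lee_fin exprn_ge0|exact: hw].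
    by rewrite -EFinM lee_fin -exprMn; have -> : 2 * 4^-1 = 2^-1 :> R by field.
  by rewrite sumEFin lee_fin sum_geo_half_le.
have intS : m.-integrable setT S.
  apply/integrableP; split => //.
  under eq_integral do rewrite gee0_abs ?nneseries_ge0//.
  by apply: le_lt_trans iS _; rewrite ltry.
apply: filterS (integrable_ae measurableT intS) => x /(_ Logic.I) fS.
apply: (@cvg_weighted_sqr_increments _ (fine (S x))) => n.
rewrite -lee_fin fineK// -sumEFin; apply: nneseries_lim_ge => k _ _; exact: s0.
Qed.

(** Riesz-Fischer: a fast subsequence converges almost everywhere, and Fatou's lemma bounds the
    distance to its limit. *)
Lemma L2ip_complete : semi_complete L2ip.
Proof.
move=> u cu.
have /choice[N hN] k : exists N : nat, forall p q, (N <= p)%N -> (N <= q)%N ->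
    L2ip (u p - u q) (u p - u q) < 4^-1 ^+ k.
  by apply: cu; rewrite exprn_gt0// invr_gt0.
(* Nondecreasing and at least [N k]; the successors also make it exceed [k], so that it is
   cofinal. *)
pose phi k := (\sum_(j < k.+1) (N j).+1)%N.
have phiN k : (N k <= phi k)%N by rewrite /phi big_ord_recr/= addnS ltnW// ltnS leq_addl.
have phiS k : (phi k <= phi k.+1)%N by rewrite /phi [leqRHS]big_ord_recr/= leq_addr.
pose w k : T -> R := u (phi k).
have mw k : measurable_fun setT (w k) by exact: L2_measurable.
have cw : {ae m, forall x, cvgn (w ^~ x)}.
  apply: ae_cvg_L2_increments => // k.
  have := hN k (phi k.+1) (phi k) (leq_trans (phiN _) (phiS _)) (phiN _).
  by rewrite -lte_fin L2ip_sqr => /ltW.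
(* The upper limit is measurable on the whole space, and [fine] sends infinite values to 0. *)
pose v x := fine (limn_esup (fun k => (w k x)%:E)).
have mv : measurable_fun setT v.
  apply: measurableT_comp => //; apply: measurable_fun_limn_esup => k.
  exact/measurable_EFinP.
have vE x : cvgn (w ^~ x) -> w ^~ x @ \oo --> v x.
  move=> /cvg_ex[l wl]; rewrite /v.
  have /cvg_limn_einf_sup[_ ->] : (fun k => (w k x)%:E) @ \oo --> l%:E.
    by apply: cvg_EFin wl; exact: nearW.
  exact: wl.
have bound (n M : nat) (e : R) : (forall k, (M <= k)%N ->
    L2ip (u n - u k) (u n - u k) <= e) ->
    (\int[m]_x ((u n x - v x) ^+ 2)%:E <= e%:E)%E.
  move=> hM.
  pose f k x := ((u n x - w k x) ^+ 2)%:E : \bar R.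
  have mf k : measurable_fun setT (f k).
    apply/measurable_EFinP; apply: measurable_funX; exact: measurable_funB.
  have f0 k x : setT x -> (0 <= f k x)%E by rewrite lee_fin sqr_ge0.
  apply: (@le_trans _ _ (\int[m]_x limn_einf (f ^~ x))%E).
    rewrite le_eqVlt; apply/orP; left; apply/eqP.
    apply: ae_eq_integral => //.
    - apply/measurable_EFinP; apply: measurable_funX; exact: measurable_funB.
    - rewrite (_ : (fun x => limn_einf (f ^~ x)) =
        (fun x => - limn_esup (\- (f ^~ x)))%E)//.
      apply: measurableT_comp => //; apply: measurable_fun_limn_esup => k.
      exact: measurableT_comp.
    - apply: filterS cw => x /vE wv _.
      have h : (fun k => (u n x - w k x) ^+ 2) @ \oo --> (u n x - v x) ^+ 2.
        under eq_fun do rewrite expr2.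
        by rewrite expr2; apply: cvgM; apply: cvgB => //; exact: cvg_cst.
      have hf : f ^~ x @ \oo --> ((u n x - v x) ^+ 2)%:E.
        by apply: cvg_EFin => //; exact: nearW.
      by rewrite (cvg_limn_einf_sup hf).1.
  apply: (le_trans (fatou _ _ _ _)) => //.
  rewrite limn_einf_lim; apply: lime_le; first exact: is_cvg_einfs.
  apply: nearW => k; apply: (@le_trans _ _ (\int[m]_x f (k + M)%N x)%E).
    apply: ereal_inf_lbound => /=; exists (k + M)%N => //=; exact: leq_addr.
  have : (M <= phi (k + M))%N.
    apply: (@leq_trans (\sum_(j < (k + M).+1) 1)%N); last exact: leq_sum.
    by rewrite sum1_card card_ord ltnW// ltnS leq_addl.
  by move=> /hM; rewrite -lee_fin L2ip_sqr.
have [N0 hN0] := cu 1 ltr01.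
have vL : v \in Lfun m 2%:E.
  apply/L2P; split => //.
  have h1 := bound N0 N0 1 (fun k hk => ltW (hN0 N0 k (leqnn N0) hk)).
  have [mu0 u0] := (L2P (u N0)).1 (LfunP _).
  have msq (f : T -> R) : measurable_fun setT f ->
      measurable_fun setT (EFin \o (fun x : T => f x ^+ 2) : T -> \bar R).
    by move=> mf; apply/measurable_EFinP; exact: measurable_funX.
  apply: (@le_lt_trans _ _ (\int[m]_x (2%:E * (u N0 x ^+ 2)%:E
      + 2%:E * ((u N0 x - v x) ^+ 2)%:E))%E).
    apply: ge0_le_integral => //.
    - by move=> x _; rewrite lee_fin sqr_ge0.
    - exact: msq.
    - apply: emeasurable_funD; apply: emeasurable_funM => //; apply: msq => //.
      exact: measurable_funB.
    - move=> x _; rewrite -!EFinM -EFinD lee_fin.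
      (* The inequality v^2 <= 2 u^2 + 2 (u - v)^2 is the nonnegativity of (2 u - v)^2. *)
      by have := sqr_ge0 (2 * u N0 x - v x); nra.
  rewrite ge0_integralD//; last 4 first.
  - by move=> x _; rewrite -EFinM lee_fin mulr_ge0// sqr_ge0.
  - by apply: emeasurable_funM => //; exact: msq.
  - by move=> x _; rewrite -EFinM lee_fin mulr_ge0// sqr_ge0.
  - by apply: emeasurable_funM => //; apply: msq; exact: measurable_funB.
  have sq0 (f : T -> R) x : setT x -> (0 <= (f x ^+ 2)%:E)%E by rewrite lee_fin sqr_ge0.
  rewrite (ge0_integralZl m measurableT (msq _ mu0) (sq0 _))//.
  rewrite (ge0_integralZl m measurableT (msq _ (measurable_funB mu0 mv)) (sq0 _))//.
  apply: lte_add_pinfty; apply: lte_mul_pinfty => //.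
  by apply: le_lt_trans h1 _; rewrite ltry.
exists (Lfun_Sub (lee1n 2) vL) => e e0.
have [|M hM] := cu (e / 2); first by rewrite divr_gt0.
exists M => n hn; apply: (@le_lt_trans _ _ (e / 2)); last by lra.
rewrite -lee_fin L2ip_sqr.
by apply: (bound n M) => k hk; rewrite ltW// hM.
Qed.

End L2.

(** * Radon-Nikodym densities and the Koopman representation *)

Section NonsingularMaps.
Context {R : realType} {d : measure_display} {X : measurableType d}
  (nu : probability X R).

(** Absolute continuity of the image measure, which is what a density requires. A dilation onto a
    set of measure less than 1 has this property without being [nonsingular]. *)
Definition null_preserving (T : X -> X) : Prop :=
  measurable_fun setT T /\
  forall B, measurable B -> nu B = 0%E -> nu (T @^-1` B) = 0%E.

Lemma nonsingular_null_preserving (T : X -> X) :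
  nonsingular nu T -> null_preserving T.
Proof. by move=> [mT nT]; split=> // B mB B0; apply/nT. Qed.

Lemma ae_preimage (T : X -> X) (P : X -> Prop) : null_preserving T ->
  {ae nu, forall x, P x} -> {ae nu, forall x, P (T x)}.
Proof.
move=> [mT nT] [A [mA A0 PA]]; exists (T @^-1` A); split.
- by rewrite -[_ @^-1` _]setTI; exact: mT.
- exact: nT.
- by move=> x /= h; exact: PA.
Qed.

Lemma integral_mulindic (m : {measure set X -> \bar R}) (f : X -> \bar R) (B : set X) :
  (\int[m]_(x in B) f x = \int[m]_x (f x * (\1_B x)%:E))%E.
Proof. by rewrite integral_mkcond epatch_indic. Qed.

Lemma measure_preimage_indic (T : X -> X) (B : set X) :
  measurable_fun setT T -> measurable B ->
  (nu (T @^-1` B) = \int[nu]_x (\1_B (T x))%:E)%E.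
Proof.
move=> mT mB.
have mTB : measurable (T @^-1` B) by rewrite -[_ @^-1` _]setTI; exact: mT.
by rewrite -[T @^-1` B]setIT -integral_indic.
Qed.

Lemma RN_density_unique (T : X -> X) (r r' : X -> R) :
  is_RN_density nu T r -> is_RN_density nu T r' -> {ae nu, forall x, r x = r' x}.
Proof.
move=> [mr r0 rE] [mr' r0' rE'].
have : ae_eq nu setT (EFin \o r) (EFin \o r').
  apply: integral_ae_eq => //.
  - apply/integrableP; split; first exact/measurable_EFinP.
    under eq_integral do rewrite /= ger0_norm//.
    by rewrite -rE// ltey_eq fin_num_measure// preimage_setT.
  - exact/measurable_EFinP.
  - by move=> E _ mE; rewrite -rE// -rE'.
by apply: filterS => x /(_ Logic.I)[].
Qed.

Lemma RN_density_ex (T : X -> X) : null_preserving T ->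
  exists2 r : X -> R, is_RN_density nu T r &
    forall F : X -> \bar R, (forall x, 0 <= F x)%E -> measurable_fun setT F ->
      (\int[nu]_x F (T x) = \int[nu]_x ((r x)%:E * F x))%E.
Proof.
move=> [mT nT].
pose T' : {mfun X >-> X} := HB.pack T (isMeasurableFun.Build _ _ _ _ T mT).
pose push := distribution nu T'.
have dom : push `<< nu.
  apply/null_content_dominatesP => A mA A0.
  exact: nT.
pose h := Radon_Nikodym_SigmaFinite.f push nu.
have h0 := Radon_Nikodym_SigmaFinite.f_ge0 dom.
have hfin := Radon_Nikodym_SigmaFinite.f_fin_num dom.
have mh : measurable_fun setT h.
  exact: measurable_int (Radon_Nikodym_SigmaFinite.f_integrable dom).
exists (fine \o h).
  split.
  - exact: measurableT_comp.
  - by move=> x; rewrite /= fine_ge0.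
  - move=> B mB; apply: etrans (Radon_Nikodym_SigmaFinite.f_integral dom mB) _.
    by apply: eq_integral => x _; rewrite /= fineK.
move=> F F0 mF; transitivity (\int[push]_x F x)%E.
  by rewrite ge0_integral_distribution.
rewrite -(Radon_Nikodym_SigmaFinite.change_of_variables dom)//.
by apply: eq_integral => x _; rewrite /= fineK// muleC.
Qed.

Lemma RN_densityP (T : X -> X) : nonsingular nu T ->
  is_RN_density nu T (RN_density nu T).
Proof.
move=> /nonsingular_null_preserving/RN_density_ex[r rP _].
by apply: ClassicalEpsilon.epsilon_spec; exists r.
Qed.

Lemma RN_density_ge0 (T : X -> X) x : nonsingular nu T -> 0 <= RN_density nu T x.
Proof. by move=> /RN_densityP[]. Qed.

Lemma measurable_RN_density (T : X -> X) : nonsingular nu T ->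
  measurable_fun setT (RN_density nu T).
Proof. by move=> /RN_densityP[]. Qed.

Lemma RN_density_null_preserving (T : X -> X) (r : X -> R) :
  measurable_fun setT T -> is_RN_density nu T r -> null_preserving T.
Proof.
move=> mT [mr _ rE]; split=> // B mB B0; rewrite rE//.
by apply: null_set_integral => //; apply/measurable_EFinP/measurable_funTS.
Qed.

Lemma integral_is_RN_density (T : X -> X) (r : X -> R) (F : X -> \bar R) :
  measurable_fun setT T -> is_RN_density nu T r ->
  (forall x, 0 <= F x)%E -> measurable_fun setT F ->
  (\int[nu]_x F (T x) = \int[nu]_x ((r x)%:E * F x))%E.
Proof.
move=> mT rP F0 mF.
have [r' rP' ->//] := RN_density_ex (RN_density_null_preserving mT rP).
have [mr _ _] := rP; have [mr' _ _] := rP'.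
apply: ae_eq_integral => //.
- by apply: emeasurable_funM => //; exact/measurable_EFinP.
- by apply: emeasurable_funM => //; exact/measurable_EFinP.
by apply: filterS (RN_density_unique rP' rP) => x -> _.
Qed.

Lemma integral_RN_density (T : X -> X) (F : X -> \bar R) : nonsingular nu T ->
  (forall x, 0 <= F x)%E -> measurable_fun setT F ->
  (\int[nu]_x F (T x) = \int[nu]_x ((RN_density nu T x)%:E * F x))%E.
Proof.
move=> nT; apply: integral_is_RN_density; first by case: nT.
exact: RN_densityP.
Qed.

End NonsingularMaps.

(** * The Koopman operators of a nonsingular action *)

Section Koopman.
Context {R : realType} {d : measure_display} {X : measurableType d}
  (nu : probability X R) {G : groupType}.
Implicit Types (c : G -> X -> X) (f : X -> R).

(** An indicator is its own square root, so [koopman c g (\1_A)] is the pointwise square root of the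
    function [U1] that defines the weak topology. *)
Definition koopman c (g : G) f : X -> R :=
  fun x => Num.sqrt (RN_density nu (c g) x) * f (c g^-1%g x).

Context (c : G -> X -> X) (cP : nonsingular_action nu c).

Lemma action_nonsingular g : nonsingular nu (c g).
Proof. by case: cP. Qed.

Lemma action_null_preserving g : null_preserving nu (c g).
Proof. exact/nonsingular_null_preserving/action_nonsingular. Qed.

Lemma measurable_action g : measurable_fun setT (c g).
Proof. by case: (action_nonsingular g). Qed.

Lemma actionVK g : {ae nu, forall x, c g^-1%g (c g x) = x}.
Proof.
have [_ cM c1] := cP.
apply: filterS2 (cM g^-1%g g) c1 => x; rewrite mulVg => <-; exact.
Qed.

Lemma measurable_koopman g f : measurable_fun setT f ->
  measurable_fun setT (koopman c g f).
Proof.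
move=> mf; apply: measurable_funM.
  apply: measurableT_comp; first by apply: continuous_measurable_fun; exact: sqrt_continuous.
  exact/measurable_RN_density/action_nonsingular.
by apply: measurableT_comp => //; exact: measurable_action.
Qed.

Lemma koopman_sqr f g x : koopman c g f x ^+ 2 =
  RN_density nu (c g) x * f (c g^-1%g x) ^+ 2.
Proof.
by rewrite exprMn sqr_sqrtr// RN_density_ge0//; exact: action_nonsingular.
Qed.

Lemma integral_koopman_sqr g f : measurable_fun setT f ->
  (\int[nu]_x (koopman c g f x ^+ 2)%:E = \int[nu]_x (f x ^+ 2)%:E)%E.
Proof.
move=> mf.
under eq_integral do rewrite koopman_sqr EFinM.
have mh : measurable_fun setT (EFin \o (fun x => f (c g^-1%g x) ^+ 2)).
  apply/measurable_EFinP; apply: measurable_funX.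
  by apply: measurableT_comp => //; exact: measurable_action.
rewrite -(integral_RN_density (action_nonsingular g) (F := EFin \o _) _ mh); last first.
  by move=> x; rewrite lee_fin sqr_ge0.
apply: ae_eq_integral => //.
- apply: (measurableT_comp mh); exact: measurable_action.
- by apply/measurable_EFinP; exact: measurable_funX.
- by apply: filterS (actionVK g) => x /= -> _.
Qed.

Lemma RN_density1 : {ae nu, forall x, RN_density nu (c 1%g) x = 1}.
Proof.
apply: (RN_density_unique (T := c 1%g)).
  exact/RN_densityP/action_nonsingular.
split => // B mB.
rewrite (measure_preimage_indic nu (measurable_action 1%g) mB).
rewrite [RHS]integral_mulindic; apply: ae_eq_integral => //.
- apply/measurable_EFinP; apply: measurableT_comp => //.
  exact: measurable_action.
- by apply: emeasurable_funM => //; exact/measurable_EFinP.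
- have [_ _ c1] := cP.
  by apply: filterS c1 => x /= -> _; rewrite mul1e.
Qed.

(** The cocycle identity: by uniqueness, it suffices that the right-hand side is a density for
    [c (g * h)]. *)
Lemma RN_densityM g h : {ae nu, forall x, RN_density nu (c (g * h)%g) x =
  RN_density nu (c g) x * RN_density nu (c h) (c g^-1%g x)}.
Proof.
apply: (RN_density_unique (T := c (g * h)%g)).
  exact/RN_densityP/action_nonsingular.
have mc := measurable_action.
have ge0 k x := RN_density_ge0 x (action_nonsingular k).
have mr k := measurable_RN_density (action_nonsingular k).
have mrh : measurable_fun setT (fun x => RN_density nu (c h) (c g^-1%g x)).
  exact: measurableT_comp.
split.
- exact: measurable_funM.
- by move=> x; rewrite mulr_ge0.
move=> B mB.
have m1 k : measurable_fun setT (fun x => (\1_B (c k x) : R)).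
  exact: measurableT_comp.
rewrite (measure_preimage_indic nu (mc _) mB).
transitivity (\int[nu]_x (\1_B (c g (c h x)))%:E)%E.
  apply: ae_eq_integral => //.
  - exact/measurable_EFinP.
  - by apply/measurable_EFinP; apply: (measurableT_comp (m1 g)).
  - by have [_ cM _] := cP; apply: filterS (cM g h) => x /= -> _.
rewrite (integral_RN_density (action_nonsingular h) (F := fun x => (\1_B (c g x))%:E));
  [|by move=> x; rewrite lee_fin|exact/measurable_EFinP].
(* Replacing [x] by [c g^-1 (c g x)] makes the integrand a function of [c g x], ready for a second
   change of variables. *)
transitivity (\int[nu]_x (fun y => (RN_density nu (c h) (c g^-1%g y) * \1_B y)%:E) (c g x))%E.
  apply: ae_eq_integral => //.
  - by apply: emeasurable_funM; exact/measurable_EFinP.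
  - apply/measurable_EFinP; apply: measurable_funM => //.
    by apply: measurableT_comp => //; apply: measurableT_comp.
  - by apply: filterS (actionVK g) => x /= -> _; rewrite EFinM.
rewrite (integral_RN_density (action_nonsingular g)
  (F := fun y => (RN_density nu (c h) (c g^-1%g y) * \1_B y)%:E)); last 2 first.
- by move=> x; rewrite lee_fin mulr_ge0.
- by apply/measurable_EFinP; apply: measurable_funM.
rewrite [RHS]integral_mulindic; apply: eq_integral => x _.
by rewrite -!EFinM mulrA.
Qed.

Lemma koopman1 f : {ae nu, forall x, koopman c 1%g f x = f x}.
Proof.
have [_ _ c1] := cP; apply: filterS2 RN_density1 c1 => x h1 h2.
by rewrite /koopman h1 sqrtr1 mul1r invg1 h2.
Qed.

Lemma koopman_mul g h f :
  {ae nu, forall x, koopman c (g * h)%g f x = koopman c g (koopman c h f) x}.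
Proof.
have [_ cM _] := cP.
apply: filterS2 (RN_densityM g h) (cM h^-1%g g^-1%g) => x h1 h2.
rewrite /koopman h1 sqrtrM ?RN_density_ge0//; last exact: action_nonsingular.
by rewrite invgM h2 mulrA.
Qed.

End Koopman.

(** * The countable direct sum of copies of [L2] *)

Section Layers.
Context {R : realType} {d : measure_display} {X : measurableType d}
  (nu : probability X R).
Local Notation Y := (X * nat)%type.

Definition layer (k : nat) (x : X) : Y := (x, k).

Lemma measurable_layer k : measurable_fun setT (layer k).
Proof. by apply: measurable_fun_pair. Qed.

HB.instance Definition _ k := isMeasurableFun.Build _ _ _ _ (layer k)
  (measurable_layer k).

(** The product of [nu] with counting measure: the Hilbert sum of countably many copies of L2
    becomes a single L2 space, complete by [L2ip_complete]. *)
Definition layers : {measure set Y -> \bar R} :=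
  mseries (fun k => distribution nu (layer k)) 0.

Lemma measurable_fun_layers (f : Y -> R) :
  (forall k, measurable_fun setT (fun x => f (x, k))) -> measurable_fun setT f.
Proof.
move=> mf _ B mB; rewrite setTI.
have -> : f @^-1` B = \bigcup_k (((fun x => f (x, k)) @^-1` B) `*` [set k]).
  apply/seteqP; split=> [[x k] /= h|[x k] [j _ [/= h kj]]]; first by exists k.
  by rewrite /= kj.
apply: bigcupT_measurable => k; apply: measurableX => //.
by rewrite -[_ @^-1` _]setTI; exact: mf.
Qed.

Lemma measurable_fun_section (f : Y -> R) k :
  measurable_fun setT f -> measurable_fun setT (fun x => f (x, k)).
Proof. by move=> mf; exact: measurableT_comp mf (measurable_layer k). Qed.

Lemma ge0_integral_layers (F : Y -> \bar R) :
  (forall y, 0 <= F y)%E -> measurable_fun setT F ->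
  (\int[layers]_y F y = \sum_(k <oo) \int[nu]_x F (x, k))%E.
Proof.
move=> F0 mF; rewrite /layers ge0_integral_measure_series//.
by apply: eq_eseriesr => k _; rewrite ge0_integral_distribution.
Qed.

(** [F] may change sign, as the products in an inner product do; the positive and negative parts are
    treated separately. *)
Lemma integral_layers_supp (F : Y -> \bar R) (k : nat) :
  measurable_fun setT F -> (forall x j, j != k -> F (x, j) = 0%E) ->
  (\int[layers]_y F y = \int[nu]_x F (x, k))%E.
Proof.
move=> mF F0.
have ge0 (H : Y -> \bar R) : measurable_fun setT H -> (forall y, 0 <= H y)%E ->
    (forall x j, j != k -> H (x, j) = 0%E) ->
    (\int[layers]_y H y = \int[nu]_x H (x, k))%E.
  move=> mH H0 Hk; rewrite ge0_integral_layers//.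
  rewrite (@nneseriesD1 _ _ k)//; last by move=> *; apply: integral_ge0 => *.
  rewrite eseries0 ?adde0// => j _ jk.
  under eq_integral do rewrite Hk//.
  by rewrite integral0.
rewrite integralE [RHS]integralE; congr (_ - _)%E.
  rewrite (ge0 (F^\+)%E)//.
  - by apply: eq_integral => x _; rewrite !funeposE.
  - exact: measurable_funepos.
  - by move=> x j jk; rewrite funeposE F0// maxxx.
rewrite (ge0 (F^\-)%E)//.
- by apply: eq_integral => x _; rewrite !funenegE.
- exact: measurable_funeneg.
- by move=> x j jk; rewrite funenegE F0// oppe0 maxxx.
Qed.

Local Notation V := (LfunType layers (lee1n 2)).

Lemma L2_layersP (f : Y -> R) : f \in Lfun layers 2%:E <->
  (forall k, measurable_fun setT (fun x => f (x, k))) /\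
  (\sum_(k <oo) \int[nu]_x (f (x, k) ^+ 2)%:E < +oo)%E.
Proof.
have mE : measurable_fun setT f -> (\int[layers]_y (f y ^+ 2)%:E =
    \sum_(k <oo) \int[nu]_x (f (x, k) ^+ 2)%:E)%E.
  move=> mf; rewrite ge0_integral_layers//.
    by move=> y; rewrite lee_fin sqr_ge0.
  by apply/measurable_EFinP; exact: measurable_funX.
split=> [/L2P[mf]|[mf fi]]; first by rewrite mE// => ?; split=> // k; exact: measurable_fun_section.
apply/L2P; split; first exact: measurable_fun_layers.
by rewrite mE//; exact: measurable_fun_layers.
Qed.

Lemma L2ip_layers (u : V) :
  ((L2ip u u)%:E = \sum_(k <oo) \int[nu]_x (u (x, k) ^+ 2)%:E)%E.
Proof.
rewrite L2ip_sqr ge0_integral_layers//.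
  by move=> y; rewrite lee_fin sqr_ge0.
by apply/measurable_EFinP; apply: measurable_funX; exact: L2_measurable.
Qed.

Lemma section_sqr_le (u : V) k :
  (\int[nu]_x (u (x, k) ^+ 2)%:E <= (L2ip u u)%:E)%E.
Proof.
rewrite L2ip_layers (@nneseriesD1 _ _ k)//.
  apply: leeDl; apply: nneseries_ge0 => *; apply: integral_ge0 => *.
  by rewrite lee_fin sqr_ge0.
by move=> *; apply: integral_ge0 => *; rewrite lee_fin sqr_ge0.
Qed.

Lemma integral_sqr_eq0 (f : X -> R) : measurable_fun setT f ->
  (\int[nu]_x (f x ^+ 2)%:E = 0)%E <-> {ae nu, forall x, f x = 0}.
Proof.
move=> mf.
have mf2 : measurable_fun setT (EFin \o (fun x => f x ^+ 2)).
  by apply/measurable_EFinP; exact: measurable_funX.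
have := ae_eq_integral_abs nu measurableT mf2.
under eq_integral do rewrite /= ger0_norm ?sqr_ge0//.
move=> ->; split; apply: filterS => x.
  by move=> /(_ Logic.I) /= [] /eqP; rewrite sqrf_eq0 => /eqP.
by move=> /= -> _; rewrite expr0n.
Qed.

Lemma L2ip_layers_eq0 (u : V) :
  L2ip u u = 0 <-> forall k, {ae nu, forall x, u (x, k) = 0}.
Proof.
have mu k : measurable_fun setT (fun x => u (x, k)).
  exact/measurable_fun_section/L2_measurable.
split=> [u0 k|h].
  apply/integral_sqr_eq0 => //; apply/eqP; rewrite eq_le.
  apply/andP; split; first by rewrite (le_trans (section_sqr_le u k))// u0.
  by apply: integral_ge0 => *; rewrite lee_fin sqr_ge0.
apply: EFin_inj; rewrite L2ip_layers eseries0// => k _ _.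
exact/integral_sqr_eq0.
Qed.

Lemma insert_L2 (k : nat) (f : X -> R) : measurable_fun setT f ->
  (\int[nu]_x (f x ^+ 2)%:E < +oo)%E ->
  (fun y : Y => if y.2 == k then f y.1 else 0) \in Lfun layers 2%:E.
Proof.
move=> mf fi; apply/L2P.
have mF : measurable_fun setT (fun y : Y => if y.2 == k then f y.1 else 0).
  by apply: measurable_fun_layers => j /=; case: eqP.
split => //; rewrite (@integral_layers_supp _ k)/= ?eqxx//.
  by apply/measurable_EFinP; exact: measurable_funX.
by move=> x j /negbTE /= ->; rewrite expr0n.
Qed.

Definition insert k f mf fi : V := Lfun_Sub (lee1n 2) (@insert_L2 k f mf fi).

Lemma insertE k f mf fi y : @insert k f mf fi y = if y.2 == k then f y.1 else 0.
Proof. by []. Qed.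

Lemma L2ip_insert (u : V) k f mf fi :
  ((L2ip u (@insert k f mf fi))%:E = \int[nu]_x (u (x, k) * f x)%:E)%E.
Proof.
rewrite L2ipE (@integral_layers_supp _ k).
- by apply: eq_integral => x _; rewrite insertE eqxx.
- apply/measurable_EFinP; apply: measurable_funM; exact: L2_measurable.
by move=> x j jk; rewrite insertE /= (negbTE jk) mulr0.
Qed.

End Layers.

(** * The direct sum of the Koopman representations *)

Section KoopmanSum.
Context {R : realType} {d : measure_display} {X : measurableType d}
  (nu : probability X R) {G : groupType}.
Context (c : nat -> G -> X -> X) (cP : forall k, nonsingular_action nu (c k)).
Local Notation V := (LfunType (layers nu) (lee1n 2)).

Lemma koopman_sum_L2 g (u : V) :
  (fun y => koopman nu (c y.2) g (fun x => u (x, y.2)) y.1)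
    \in Lfun (layers nu) 2%:E.
Proof.
have mu k : measurable_fun setT (fun x => u (x, k)).
  exact/measurable_fun_section/L2_measurable.
apply/L2_layersP; split=> [k|] /=; first exact: measurable_koopman.
under eq_eseriesr do rewrite integral_koopman_sqr//.
by rewrite -L2ip_layers ltry.
Qed.

Definition koopman_sum g (u : V) : V := Lfun_Sub (lee1n 2) (koopman_sum_L2 g u).

Lemma koopman_sumE g (u : V) x k :
  koopman_sum g u (x, k) = koopman nu (c k) g (fun z => u (z, k)) x.
Proof. by []. Qed.

Lemma koopman_sum_rep : almost_orthogonal_rep (@L2ip _ _ _ (layers nu)) koopman_sum.
Proof.
have mu k (u : V) : measurable_fun setT (fun x => u (x, k)).
  exact/measurable_fun_section/L2_measurable.
split.
- move=> g a u v; apply/LfuneqP => -[x k].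
  rewrite -[RHS]/(a * koopman_sum g u (x, k) + koopman_sum g v (x, k)).
  by rewrite !koopman_sumE /koopman -[(a *: u + v) _]/(a * u _ + v _); ring.
- move=> g u; apply: EFin_inj; rewrite !L2ip_layers.
  by apply: eq_eseriesr => k _; rewrite -(integral_koopman_sqr (cP k) g (mu k u)).
- move=> u; apply/L2ip_layers_eq0 => k.
  apply: filterS (koopman1 (cP k) (fun z => u (z, k))) => x h.
  by rewrite -[LHS]/(koopman_sum 1%g u (x, k) - u (x, k)) koopman_sumE h subrr.
- move=> g h u; apply/L2ip_layers_eq0 => k.
  apply: filterS (koopman_mul (cP k) g h (fun z => u (z, k))) => x e.
  rewrite -[LHS]/(koopman_sum (g * h)%g u (x, k) - koopman_sum g (koopman_sum h u) (x, k)).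
  by rewrite koopman_sumE e koopman_sumE subrr.
Qed.

End KoopmanSum.

(* The condition [\int xi = 0] on the layers in [M] removes the constants,
   which are invariant there. *)
Lemma property_T_koopman {R : realType} {d : measure_display}
    {X : measurableType d} (nu : probability X R) (G : groupType)
    (c : nat -> G -> X -> X) (M : set nat) (f : nat -> X -> R) :
  property_T (R := R) G -> (forall k, nonsingular_action nu (c k)) ->
  (forall k, M k -> forall g, {ae nu, forall x, koopman nu (c k) g (cst 1) x = 1}) ->
  (forall k, measurable_fun setT (f k)) ->
  (forall k, 0 < \int[nu]_x (f k x ^+ 2)%:E < +oo)%E ->
  (forall k, M k -> \int[nu]_x (f k x)%:E = 0)%E ->
  (forall (Q : seq G) (e : R), 0 < e -> exists k, forall g, g \in Q ->
    (\int[nu]_x ((koopman nu (c k) g (f k) x - f k x) ^+ 2)%:E <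
     e%:E * \int[nu]_x (f k x ^+ 2)%:E)%E) ->
  exists (k : nat) (xi : X -> R), [/\ measurable_fun setT xi,
    (0 < \int[nu]_x (xi x ^+ 2)%:E < +oo)%E,
    forall g, {ae nu, forall x, koopman nu (c k) g xi x = xi x} &
    (M k -> \int[nu]_x (xi x)%:E = 0)%E].
Proof.
move=> TG cP M1 mf f2 f0 almost.
pose ip := @L2ip _ _ _ (layers nu).
have fi k : (\int[nu]_x (f k x ^+ 2)%:E < +oo)%E by have /andP[] := f2 k.
have ipP : semi_ip ip := L2ip_semi (layers nu).
have one_fi : (\int[nu]_x ((cst 1 x : R) ^+ 2)%:E < +oo)%E.
  under eq_integral do rewrite expr1n.
  by rewrite integral_cst//= mul1e ltey_eq fin_num_measure.
pose one k := insert k (@measurable_cst _ _ X R setT 1) one_fi.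
pose N := [set e | exists2 k, M k & e = one k].
have [piL piI _ _] := koopman_sum_rep cP.
have ip_one u k : ((ip u (one k))%:E = \int[nu]_x (u (x, k))%:E)%E.
  by rewrite L2ip_insert; apply: eq_integral => x _; rewrite mulr1.
have subE (u w : LfunType (layers nu) (lee1n 2)) y : (u - w) y = u y - w y by [].
have [||u [uN u0 uinv]] := property_T_semi (N := N) TG ipP
  (@L2ip_complete _ _ _ (layers nu)) (koopman_sum_rep cP).
(* With k in [M], [one k] is fixed up to a null vector, so <pi g u, one k> = <pi g u, pi g (one k)>
   = <u, one k> = 0. *)
- move=> g u uN _ [k Mk ->].
  have null : ip (one k - koopman_sum cP g (one k)) (one k - koopman_sum cP g (one k)) = 0.
    apply/L2ip_layers_eq0 => j.
    have [->|jk] := eqVneq j k.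
      apply: filterS (M1 k Mk g) => x.
      move=> h; rewrite -[LHS]/(one k (x, k) - koopman_sum cP g (one k) (x, k)).
      rewrite koopman_sumE (_ : (fun z => one k (z, k)) = cst 1) ?h.
        by rewrite insertE eqxx subrr.
      by apply/funext => z; rewrite insertE eqxx.
    apply: aeW => x.
    rewrite -[LHS]/(one k (x, j) - koopman_sum cP g (one k) (x, j)).
    by rewrite koopman_sumE insertE/= (negbTE jk) /koopman mulr0 subrr.
  have := semi_ip_null ipP (koopman_sum cP g u) null.
  rewrite (semi_ipBl ipP) => /eqP; rewrite subr_eq0 => /eqP.
  rewrite (semi_ipC ipP) => ->; rewrite (semi_ipC ipP).
  rewrite (semi_ip_isometry ipP (A := koopman_sum cP g)) //.
    by apply: uN; exists k.
  by move=> v w; have := piL g 1 v w; rewrite !scale1r.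
- move=> Q e e0; have [k hk] := almost Q e e0.
  pose v := insert k (mf k) (fi k).
  have vv : ((ip v v)%:E = \int[nu]_x (f k x ^+ 2)%:E)%E.
    by rewrite L2ip_insert; apply: eq_integral => x _; rewrite insertE eqxx expr2.
  exists v; split.
  + move=> _ [j Mj ->]; apply: EFin_inj; rewrite ip_one.
    have [jk|jk] := eqVneq j k; last first.
      under eq_integral do rewrite insertE /= (negbTE jk).
      by rewrite integral0.
    rewrite jk in Mj *; rewrite -[RHS](f0 k Mj).
    by apply: eq_integral => x _; rewrite insertE eqxx.
  + by rewrite -lte_fin vv; have /andP[] := f2 k.
  + move=> g gQ; rewrite -lte_fin EFinM vv; apply: le_lt_trans (hk g gQ).
    rewrite L2ip_sqr (@integral_layers_supp _ _ _ _ _ k).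
    * rewrite le_eqVlt; apply/orP; left; apply/eqP; apply: eq_integral => x _.
      by rewrite subE koopman_sumE insertE eqxx /koopman insertE eqxx.
    * by apply/measurable_EFinP; apply: measurable_funX; exact: L2_measurable.
    * move=> x j jk.
      by rewrite subE koopman_sumE insertE (negbTE jk) /koopman insertE (negbTE jk) mulr0 subrr expr0n.
(* The representation acts layer by layer, so a layer of the invariant vector that does not vanish
   is itself an invariant vector. *)
have [k uk] : exists k, ~ {ae nu, forall x, u (x, k) = 0}.
  apply/existsNP => h; have : ip u u = 0 by apply/L2ip_layers_eq0.
  by move=> h0; rewrite h0 ltxx in u0.
have muk : measurable_fun setT (fun x => u (x, k)).
  exact/measurable_fun_section/L2_measurable.
exists k, (fun x => u (x, k)); split => //.
- apply/andP; split; last by apply: le_lt_trans (section_sqr_le u k) _; rewrite ltry.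
  rewrite lt_def integral_ge0 ?andbT; last by move=> *; rewrite lee_fin sqr_ge0.
  by apply/eqP => /(integral_sqr_eq0 nu muk).
- move=> g; have /L2ip_layers_eq0 /(_ k) := uinv g; apply: filterS => x.
  rewrite -[X in X = _]/(koopman_sum cP g u (x, k) - u (x, k)) koopman_sumE => /eqP.
  by rewrite subr_eq0 => /eqP.
- by move=> Mk; rewrite -ip_one uN//; exists k.
Qed.

(** * Almost sure properties *)

Section EsumLemmas.
Context {R : realType} {I : choiceType}.
Local Open Scope ereal_scope.

Lemma esumZl (a : R) (f : I -> \bar R) : (0 <= a)%R -> (forall i, 0 <= f i) ->
  \esum_(i in [set: I]) (a%:E * f i) = a%:E * \esum_(i in [set: I]) f i.
Proof.
have le (b : R) (h : I -> \bar R) : (0 <= b)%R -> (forall i, 0 <= h i) ->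
    \esum_(i in [set: I]) (b%:E * h i) <= b%:E * \esum_(i in [set: I]) h i.
  move=> b0 h0; apply: ge_ereal_sup => _ [A fA <-].
  rewrite -ge0_mule_fsumr//; apply: lee_wpmul2l; first by rewrite lee_fin.
  by apply: ereal_sup_ubound; exists A.
move=> a0 f0; have [->|an0] := eqVneq a 0%R.
  rewrite mul0e; under eq_esum do rewrite mul0e.
  by rewrite esum1.
apply/eqP; rewrite eq_le le//=.
have a1 : (0 < a)%R by rewrite lt_def an0.
rewrite -lee_pdivlMl//.
have := le a^-1%R (fun i => a%:E * f i); rewrite invr_ge0 => /(_ a0).
under eq_esum do rewrite muleA -EFinM mulVf// mul1e.
by apply => i; rewrite mule_ge0.
Qed.

Lemma esum_term_le (f : I -> \bar R) i : (forall j, 0 <= f j) ->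
  f i <= \esum_(j in [set: I]) f j.
Proof.
move=> f0; rewrite (esumID [set i])// setTI esum_set1//.
by apply: leeDl; apply: esum_ge0.
Qed.

End EsumLemmas.

Section AlmostSure.
Context {R : realType} {d : measure_display} {X : measurableType d}
  (nu : probability X R).

Lemma ae_notin (A : set X) : measurable A -> nu A = 0%E <-> {ae nu, forall x, ~ A x}.
Proof.
move=> mA; split=> [A0|].
  by exists A; split => // x /= /contrapT.
move=> [B [mB B0 AB]]; apply/eqP; rewrite eq_le measure_ge0 andbT -B0.
by apply: le_measure; rewrite ?inE// => x Ax; apply: AB => /(_ Ax).
Qed.

Lemma ae_in (A : set X) : measurable A -> nu A = 1%E <-> {ae nu, forall x, A x}.
Proof.
move=> mA; have := ae_notin (measurableC mA); rewrite probability_setC// => hC.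
have -> : (nu A = 1%E) <-> (1 - nu A = 0)%E.
  split=> [->|]; first by rewrite subee.
  rewrite -(fineK (fin_num_measure nu _ mA)) -EFinB => -[h1].
  by congr EFin; lra.
rewrite hC; split; apply: filterS => x; first by move=> /contrapT.
by move=> Ax; apply.
Qed.

Lemma ae_absurd : ~ {ae nu, forall x, False}.
Proof.
move=> h; have /(ae_in measurable0) : {ae nu, forall x, (set0 : set X) x} by [].
by rewrite measure0 => /eqP; rewrite eq_sym onee_eq0.
Qed.

(** The constant is the supremum of the levels whose sublevel set is null. Without such levels, or
    with unbounded ones, [f] would be below every [- n] or above every [n] almost everywhere. *)
Lemma ae_constant (f : X -> R) : measurable_fun setT f ->
  (forall t, nu [set x | f x < t] = 0%E \/ nu [set x | f x < t] = 1%E) ->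
  exists t, {ae nu, forall x, f x = t}.
Proof.
move=> mf h.
have mlt t : measurable [set x | f x < t].
  rewrite -[X in measurable X]setTI; exact: measurable_fun_ltr.
pose A := [set t | nu [set x | f x < t] = 0%E].
have hlt t : ~ A t -> {ae nu, forall x, f x < t}.
  by move=> nA; apply/(ae_in (mlt t)); case: (h t).
have hge t : A t -> {ae nu, forall x, t <= f x}.
  by move=> /(ae_notin (mlt t)); apply: filterS => x /negP; rewrite -leNgt.
have A0 : A !=set0.
  apply: contrapT => nA; apply: ae_absurd.
  have /ae_foralln : forall n : nat, {ae nu, forall x, f x < - n%:R}.
    by move=> n; apply: hlt => An; apply: nA; exists (- n%:R).
  apply: filterS => x hx.
  have := hx (Num.bound `|f x|); apply/negP; rewrite -leNgt lerNl.
  apply: (le_trans (ler_norm _)); rewrite normrN ltW//; exact: archi_boundP.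
have Aub : has_ubound A.
  apply: contrapT => nA; apply: ae_absurd.
  have /ae_foralln : forall n : nat, {ae nu, forall x, n%:R <= f x}.
    move=> n; have : exists2 t, A t & n%:R < t.
      apply: contrapT => ex; apply: nA; exists n%:R => t At.
      by rewrite leNgt; apply/negP => nt; apply: ex; exists t.
    move=> [t At nt]; apply: filterS (hge t At) => x; exact/le_trans/ltW.
  apply: filterS => x hx; have := hx (Num.bound `|f x|).
  apply/negP; rewrite -ltNge.
  exact: (le_lt_trans (ler_norm _) (archi_boundP (normr_ge0 _))).
have supA : has_sup A by split.
exists (sup A).
have inv0 n : 0 < n.+1%:R^-1 :> R by rewrite invr_gt0.
have low : {ae nu, forall x, forall n : nat, sup A - n.+1%:R^-1 <= f x}.
  apply/ae_foralln => n; have [t At ht] := sup_adherent (inv0 n) supA.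
  by apply: filterS (hge t At) => x; exact/le_trans/ltW.
have up : {ae nu, forall x, forall n : nat, f x < sup A + n.+1%:R^-1}.
  apply/ae_foralln => n; apply: hlt => /(ub_le_sup Aub).
  by rewrite gerDl leNgt inv0.
apply: filterS2 low up => x hl hu.
have eps (e : R) : 0 < e -> exists n : nat, n.+1%:R^-1 < e.
  move=> e0; exists (Num.bound e^-1).
  rewrite invf_plt ?posrE// (lt_trans (archi_boundP _))// ?ltr_nat//.
  by rewrite invr_ge0 ltW.
apply/eqP; rewrite eq_le; apply/andP; split; apply/ler_addgt0Pr => e /eps[n ne].
  by apply: ltW; apply: (lt_trans (hu n)); rewrite ltrD2l.
by rewrite -lerBlDr; apply: le_trans (hl n); rewrite lerD2l lerN2 ltW.
Qed.

End AlmostSure.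

(** * Ergodic stationary actions with an invariant vector *)

Section Rigidity.
Context {R : realType} {d : measure_display} {X : measurableType d}
  (nu : probability X R).

Lemma integrable_mulindic (f : X -> R) (A : set X) : measurable A ->
  nu.-integrable setT (EFin \o f) ->
  nu.-integrable setT (EFin \o (fun x => f x * \1_A x)).
Proof.
move=> mA fi; have mf : measurable_fun setT f by apply/measurable_EFinP/(measurable_int nu).
apply: le_integrable fi => //.
  by apply/measurable_EFinP; exact: measurable_funM.
move=> x _ /=; rewrite lee_fin normrM ler_piMr// indicE.
by case: (x \in A); rewrite ?normr1 ?normr0.
Qed.

(* Bathtub principle: [(t - eta) (1_P - 1_B) >= 0] for [P = {eta < t}]. *)
Lemma sublevel_maximal (eta : X -> R) (t : R) (B : set X) :
  let P := [set x | eta x < t] in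
  nu.-integrable setT (EFin \o eta) -> 0 < t -> measurable B ->
  (\int[nu]_(x in B) (eta x)%:E = \int[nu]_(x in P) (eta x)%:E)%E ->
  (nu B <= nu P)%E /\
  (nu B = nu P -> nu (P `\` B) = 0%E /\ nu (B `\` P) = 0%E).
Proof.
move=> P etai t0 mB mBP.
have meta : measurable_fun setT eta by apply/measurable_EFinP/(measurable_int nu).
have mP : measurable P.
  rewrite -[X in measurable X]setTI; exact: measurable_fun_ltr.
have ci : nu.-integrable setT (EFin \o cst t).
  exact: finite_measure_integrable_cst.
pose I (f : X -> R) A := Rintegral nu setT (fun x => f x * \1_A x).
have IE f A : (\int[nu]_(x in A) (f x)%:E)%E = (\int[nu]_x (f x * \1_A x)%:E)%E.
  by rewrite integral_mulindic; apply: eq_integral => x _; rewrite EFinM.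
have It A : measurable A -> I (cst t) A = t * fine (nu A).
  move=> mA; rewrite /I /Rintegral -IE.
  rewrite -[integral _ _ _]/(\int[nu]_(x in A) cst t%:E x)%E integral_cst//.
  by rewrite fineM// fin_num_measure.
have Ieta : I eta B = I eta P by rewrite /I /Rintegral -!IE mBP.
pose D x := (t - eta x) * (\1_P x - \1_B x).
have D0 x : 0 <= D x.
  rewrite /D !indicE; case: (boolP (x \in P)) => [|].
    rewrite inE => /= xP; case: (x \in B); rewrite ?subrr ?mulr0 ?subr0//.
    by rewrite mulr1 subr_ge0 ltW.
  move=> /negP; rewrite inE => /= /negP; rewrite -leNgt => xP.
  by case: (x \in B) => /=; rewrite ?subr0 ?mulr0// sub0r mulrN1 opprB subr_ge0.
have Di : nu.-integrable setT (EFin \o D).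
  pose q (f : X -> R) (A : set X) := EFin \o (fun x => f x * \1_A x).
  rewrite (_ : EFin \o D = ((q (cst t) P \- q eta P) \- (q (cst t) B \- q eta B))%E).
    by do 2 apply: integrableB => //; exact: integrable_mulindic.
  by apply/funext => x; rewrite /q /D /= -!EFinB; congr EFin; ring.
have ID : Rintegral nu setT D = t * (fine (nu P) - fine (nu B)).
  transitivity (Rintegral nu setT (fun x =>
     ((cst t x * \1_P x - eta x * \1_P x) - (cst t x * \1_B x - eta x * \1_B x)))).
    by apply: eq_Rintegral => x _; rewrite /D /=; ring.
  rewrite RintegralB//; last 2 first.
  - apply: (integrableB _ (integrable_mulindic mP ci) (integrable_mulindic mP etai)) => //.
  - apply: (integrableB _ (integrable_mulindic mB ci) (integrable_mulindic mB etai)) => //.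
  rewrite !RintegralB//; try exact: integrable_mulindic.
  rewrite -/(I (cst t) P) -/(I (cst t) B) -/(I eta P) -/(I eta B).
  by rewrite Ieta !It//; ring.
split.
  rewrite -(fineK (fin_num_measure nu _ mB)) -(fineK (fin_num_measure nu _ mP)) lee_fin.
  by rewrite -subr_ge0 -(pmulr_rge0 _ t0) -ID; apply: Rintegral_ge0 => x _; exact: D0.
move=> BP; rewrite BP subrr mulr0 in ID.
have Dae : ae_eq nu setT (EFin \o D) (cst 0%E).
  apply/(ae_eq_integral_abs nu measurableT); first exact: measurable_int Di.
  under eq_integral do rewrite /= ger0_norm//.
  have := integrable_fin_num measurableT Di.
  by move: ID; rewrite /Rintegral /= => h /fineK <-; rewrite h.
(* Here [D = t - eta] is strictly positive on this set, while [D] vanishes almost everywhere. *)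
have PB : nu (P `\` B) = 0%E.
  apply/(ae_notin nu (measurableD mP mB)).
  apply: filterS Dae => x /(_ Logic.I) /= [] Dx [Px Bx].
  move: Dx; rewrite /D !indicE mem_set// memNset// subr0 mulr1.
  by move=> /eqP; rewrite subr_eq0 => /eqP h; move: Px; rewrite /P /= h ltxx.
(* On the set of points of [B] outside [P], [D] also vanishes where [eta = t], so this half is
   deduced from [nu B = nu P] instead. *)
split => //.
have hB : nu B = (nu (B `\` P) + nu (B `&` P))%E := measureDI nu mB mP.
have hP : nu P = (nu (P `\` B) + nu (P `&` B))%E := measureDI nu mP mB.
move: hB; rewrite BP hP PB add0e setIC.
rewrite -(fineK (fin_num_measure nu _ (measurableI _ _ mB mP))).
rewrite -(fineK (fin_num_measure nu _ (measurableD mB mP))) -EFinD => -[h].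
by congr EFin; lra.
Qed.

Context {G : groupType} (mu : G -> R) (c : G -> X -> X).
Hypotheses (mu1 : probability_on mu) (mugen : generating mu)
  (cmu : A_mu nu mu c) (cerg : ergodic nu c).

Let cP : nonsingular_action nu c. Proof. by case: cmu. Qed.

Lemma stationary_extremal (P : set X) : measurable P ->
  (forall g, nu (c g @^-1` P) <= nu P)%E ->
  forall g, 0 < mu g -> nu (c g @^-1` P) = nu P.
Proof.
move=> mP le g mug.
have [mu0 mus] := mu1; have [_ stat] := cmu.
have mcP k : measurable (c k @^-1` P).
  by rewrite -[_ @^-1` _]setTI; exact: (measurable_action cP).
pose n (A : set X) := fine (nu A).
have nE A : measurable A -> nu A = (n A)%:E by move=> mA; rewrite /n fineK//; exact: fin_num_measure.
pose dl k := n P - n (c k @^-1` P).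
have dl0 k : 0 <= dl k by move: (le k); rewrite !nE// lee_fin subr_ge0.
have h1 : (\esum_(k in [set: G]) ((mu k)%:E * nu (c k @^-1` P)) = (n P)%:E)%E.
  by rewrite stat// nE.
have h2 : (\esum_(k in [set: G]) (mu k * n P)%:E = (n P)%:E)%E.
  under eq_esum do rewrite mulrC EFinM.
  rewrite esumZl ?mus ?mule1 ?fine_ge0//.
have h3 : (\esum_(k in [set: G]) (mu k * dl k)%:E = 0)%E.
  have : (\esum_(k in [set: G]) (mu k * n P)%:E =
      \esum_(k in [set: G]) ((mu k)%:E * nu (c k @^-1` P)) +
      \esum_(k in [set: G]) (mu k * dl k)%:E)%E.
    rewrite -esumD; last 2 first.
    - by move=> k _; rewrite mule_ge0 ?lee_fin ?measure_ge0.
    - by move=> k _; rewrite lee_fin mulr_ge0.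
    by apply: eq_esum => k _; rewrite nE// -EFinM -EFinD /dl; congr EFin; ring.
  rewrite h1 h2; move: (esum _ _) => [r||]//; rewrite -EFinD => -[h].
  by congr EFin; lra.
have : ((mu g * dl g)%:E <= 0)%E.
  rewrite -h3; apply: (esum_term_le (f := fun k => (mu k * dl k)%:E)) => k.
  by rewrite lee_fin mulr_ge0.
rewrite lee_fin pmulr_rle0// /dl => h.
by rewrite !nE//; congr EFin; apply/eqP; rewrite eq_sym -subr_eq0 eq_le h dl0.
Qed.

(** Induction on a word in the support of [mu]; a null set of exceptions pulled back along the
    action stays null. *)
Lemma invariant_of_support (P : set X) :
  (forall g, 0 < mu g -> {ae nu, forall x, P (c g x) <-> P x}) ->
  forall g, {ae nu, forall x, P (c g x) <-> P x}.
Proof.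
move=> h g; have [s [_ sP ->]] := mugen g.
have [_ cM c1] := cP.
elim: s sP => [_|k s IH /= /andP[k0 /IH {}IH]] /=.
  by apply: filterS c1 => x ->.
apply: filterS3 (cM k (foldr (fun h k => (h * k)%g) 1%g s))
  (ae_preimage (action_null_preserving cP (foldr (fun h k => (h * k)%g) 1%g s)) (h k k0)) IH.
by move=> x -> h1 h2; rewrite h1.
Qed.

Lemma ergodic_invariant (P : set X) : measurable P ->
  (forall g, {ae nu, forall x, P (c g x) <-> P x}) ->
  nu P = 0%E \/ nu P = 1%E.
Proof.
move=> mP inv; apply: cerg => // g.
have mcP : measurable (c g @^-1` P).
  by rewrite -[_ @^-1` _]setTI; exact: (measurable_action cP).
split.
- apply/(ae_notin nu (measurableD mcP mP)).
  by apply: filterS (inv g) => x h [/= /h].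
- apply/(ae_notin nu (measurableD mP mcP)).
  by apply: filterS (inv g) => x h [/= /h].
Qed.

Section InvariantVector.
Context (xi : X -> R) (mxi : measurable_fun setT xi)
  (xi2 : (0 < \int[nu]_x (xi x ^+ 2)%:E < +oo)%E)
  (xiinv : forall g, {ae nu, forall x, koopman nu c g xi x = xi x}).
Let eta x := xi x ^+ 2.

(** Squaring the invariance of [xi] gives that [eta x] is the density of [c g] at [x] times
    [eta (c g^-1 x)], which is invariance of the measure with density [eta]. *)
Lemma invariant_density g (B : set X) : measurable B ->
  (\int[nu]_(x in c g @^-1` B) (eta x)%:E = \int[nu]_(x in B) (eta x)%:E)%E.
Proof.
move=> mB; have mc := measurable_action cP.
have meta : measurable_fun setT eta by exact: measurable_funX.
have mcB : measurable (c g @^-1` B).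
  by rewrite -[_ @^-1` _]setTI; exact: mc.
rewrite integral_mulindic [RHS]integral_mulindic.
pose F y := (eta (c g^-1%g y) * \1_B y)%:E.
have mF : measurable_fun setT F.
  apply/measurable_EFinP; apply: measurable_funM => //.
  by apply: measurableT_comp => //; exact: mc.
transitivity (\int[nu]_x F (c g x))%E.
  apply: ae_eq_integral => //.
  - by apply: emeasurable_funM; exact/measurable_EFinP.
  - exact: measurableT_comp.
  - by apply: filterS (actionVK cP g) => x hx _; rewrite /F hx EFinM.
rewrite (integral_RN_density (action_nonsingular cP g) _ mF); last first.
  by move=> x; rewrite lee_fin mulr_ge0// sqr_ge0.
apply: ae_eq_integral => //.
- apply: emeasurable_funM => //; apply/measurable_EFinP.
  exact/measurable_RN_density/action_nonsingular.
- by apply: emeasurable_funM; exact/measurable_EFinP.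
- apply: filterS (xiinv g) => x hx _; rewrite /F -!EFinM mulrA; congr EFin.
  by rewrite /eta -(koopman_sqr cP) hx.
Qed.

Lemma invariant_vector_constant :
  (forall g, {ae nu, forall x, koopman nu c g (cst 1) x = 1}) /\
  (\int[nu]_x (xi x)%:E <> 0)%E.
Proof.
have meta : measurable_fun setT eta by exact: measurable_funX.
have mlt (f : X -> R) t : measurable_fun setT f -> measurable [set x | f x < t].
  move=> mf; rewrite -[X in measurable X]setTI; exact: measurable_fun_ltr.
have etai : nu.-integrable setT (EFin \o eta).
  apply/integrableP; split; first exact/measurable_EFinP.
  under eq_integral do rewrite /= ger0_norm ?sqr_ge0//.
  by have /andP[] := xi2.
have [t0 etat0] : exists t, {ae nu, forall x, eta x = t}.
  apply: ae_constant => // t; have mP := mlt _ t meta.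
  have [t0|t0] := leP t 0.
    left; rewrite (_ : [set x | _] = set0) ?measure0//.
    apply/seteqP; split => // x /= h; have := lt_le_trans h t0.
    by rewrite ltNge sqr_ge0.
  apply: ergodic_invariant => //; apply: invariant_of_support => g g0.
  have mcP k : measurable (c k @^-1` [set x | eta x < t]).
    by rewrite -[_ @^-1` _]setTI; exact: (measurable_action cP).
  have smax k := sublevel_maximal etai t0 (mcP k) (invariant_density k mP).
  have [|h1 h2] := (smax g).2.
    by apply: stationary_extremal => // k; exact: (smax k).1.
  have /(ae_notin nu (measurableD mP (mcP g))) n1 := h1.
  have /(ae_notin nu (measurableD (mcP g) mP)) n2 := h2.
  apply: filterS2 n1 n2 => x n1 n2; split => hx.
    by apply: contrapT => nx; apply: n2.
  by apply: contrapT => nx; apply: n1.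
have t0n0 : t0 != 0.
  apply/eqP => t00; have /andP[+ _] := xi2.
  rewrite (_ : integral _ _ _ = 0%E) ?ltxx//.
  apply/(integral_sqr_eq0 nu mxi); apply: filterS etat0 => x.
  by rewrite t00 => /eqP; rewrite sqrf_eq0 => /eqP.
(* Squared invariance now reads t0 = rho t0 with t0 nonzero. *)
have rho1 g : {ae nu, forall x, RN_density nu (c g) x = 1}.
  apply: filterS3 (xiinv g) etat0 (ae_preimage (action_null_preserving cP g^-1%g) etat0).
  move=> x h1 h2 h3; have := koopman_sqr cP xi g x.
  rewrite h1 -/(eta x) -/(eta (c g^-1%g x)) h2 h3 => /eqP.
  by rewrite -subr_eq0 -{1}[t0]mul1r -mulrBl mulf_eq0 (negbTE t0n0) orbF subr_eq0 => /eqP.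
split.
  by move=> g; apply: filterS (rho1 g) => x; rewrite /koopman => ->; rewrite sqrtr1 mulr1.
have xiinv' g : {ae nu, forall x, xi (c g x) = xi x}.
  apply: filterS2 (rho1 g^-1%g) (xiinv g^-1%g) => x.
  by rewrite /koopman invgK => ->; rewrite sqrtr1 mul1r.
(* A constant square leaves the sign of [xi] open, so ergodicity is used once more, on the sublevel
   sets of [xi]. *)
have [k xik] : exists t, {ae nu, forall x, xi x = t}.
  apply: ae_constant => // t; apply: ergodic_invariant; first exact: mlt.
  by move=> g; apply: filterS (xiinv' g) => x /= ->.
have -> : (\int[nu]_x (xi x)%:E = k%:E)%E.
  rewrite (ae_eq_integral (cst k%:E))//; last 2 first.
  - exact/measurable_EFinP.
  - by apply: filterS xik => x -> _.
  by rewrite integral_cst// -[X in (_ * X)%E]/(nu setT) probability_setT mule1.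
move=> -[k0]; apply: (@ae_absurd _ _ _ nu).
apply: filterS2 xik etat0 => x; rewrite /eta => ->; rewrite k0 expr0n => h.
by move: t0n0; rewrite -h eqxx.
Qed.

End InvariantVector.
End Rigidity.

(** * Dilations of a standard space *)

Section LebesgueScaling.
Context {R : realType}.
Local Notation lambda := (@lebesgue_measure R).

(** [t] times the image of Lebesgue measure under multiplication by [t] agrees with Lebesgue measure
    on half-open intervals, hence everywhere. *)
Lemma lebesgue_measure_scale (t : R) (A : set (measurableTypeR R)) : 0 < t -> measurable A ->
  (lambda ((fun y => (t * y)%R) @^-1` A) = (t^-1)%:E * lambda A)%E.
Proof.
move=> t0 mA.
have t0' : 0 <= t by exact: ltW.
have mt : measurable_fun setT (fun y : measurableTypeR R => t * y : measurableTypeR R).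
  by apply: measurable_funM.
pose T : {mfun (measurableTypeR R) >-> (measurableTypeR R)} :=
  HB.pack (fun y : measurableTypeR R => t * y : measurableTypeR R)
    (isMeasurableFun.Build _ _ _ _ _ mt).
have mE : (lambda A = t%:E * pushforward lambda T A)%E.
  apply: (@lebesgue_measure_unique _ (mscale (NngNum t0') (pushforward lambda T))) => //.
  move=> _ [[a b] _ <-] /=; rewrite /mscale /= /pushforward.
  have -> : T @^-1` `]a, b] = `]t^-1 * a, t^-1 * b]%classic.
    apply/seteqP; split => y /=; rewrite !in_itv/= => /andP[h1 h2].
      by rewrite ltr_pdivrMl// h1 ler_pdivlMl.
    by rewrite -ltr_pdivrMl// h1 -ler_pdivlMl.
  rewrite !lebesgue_measure_itv/= !lte_fin ltr_pM2l ?invr_gt0//.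
  case: ifP => _; last by rewrite mule0.
  by rewrite -!EFinB -EFinM -mulrBr mulrA divff ?mul1r// gt_eqF.
by rewrite [in RHS]mE muleA -EFinM mulVf ?gt_eqF// mul1e.
Qed.

End LebesgueScaling.

Section Dilation.
Context {R : realType} {d : measure_display} {X : measurableType d}
  (nu : probability X R).
Local Notation lambda := (@lebesgue_measure R).

Lemma ae_measure_eq (A B : set X) : measurable A -> measurable B ->
  {ae nu, forall x, A x <-> B x} -> nu A = nu B.
Proof.
move=> mA mB h; rewrite -[A]setIT -[B]setIT -!integral_indic//.
apply: ae_eq_integral => //; [exact/measurable_EFinP..|].
apply: filterS h => x h _; congr EFin; rewrite !indicE; congr (_%:R).
by congr nat_of_bool; apply/idP/idP; rewrite !inE => /h.
Qed.

(** [D] identifies the space with [X0] and scales [nu] by [s]. Its inverse [D'] is unconstrained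
    outside [X0], which is why later formulas weight it by [\1_X0]. *)
Record dilation (s : R) (X0 : set X) (D D' : X -> X) : Prop := Dilation {
  dilation_gt0 : 0 < s;
  measurable_dilation_range : measurable X0;
  measurable_dilation : measurable_fun setT D;
  measurable_dilation_inv : measurable_fun setT D';
  dilation_density : is_RN_density nu D (fun x => s^-1 * \1_X0 x);
  dilationK : {ae nu, forall x, D' (D x) = x};
  dilationVK : {ae nu, forall x, X0 x -> D (D' x) = x} }.

Section DilationTheory.
Context (s : R) (X0 : set X) (D D' : X -> X) (dil : dilation s X0 D D').

Let mD := measurable_dilation dil.
Let mD' := measurable_dilation_inv dil.
Let mX0 := measurable_dilation_range dil.
Let s0 := dilation_gt0 dil.

Lemma measure_preimage_dilation B : measurable B ->
  (s%:E * nu (D @^-1` B) = nu (B `&` X0))%E.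
Proof.
move=> mB; have [_ _ ->//] := dilation_density dil.
under eq_integral do rewrite EFinM.
rewrite ge0_integralZl//; last by rewrite lee_fin invr_ge0 ltW.
  by rewrite integral_indic// muleA -EFinM divff ?gt_eqF// mul1e setIC.
exact/measurable_EFinP.
Qed.

Lemma dilation_in : {ae nu, forall x, X0 (D x)}.
Proof.
have mC : measurable (D @^-1` (~` X0)).
  by rewrite -[_ @^-1` _]setTI; apply: mD => //; exact: measurableC.
have : nu (D @^-1` (~` X0)) = 0%E.
  have := measure_preimage_dilation (measurableC mX0).
  rewrite setICl measure0 => /eqP; rewrite mule_eq0 eqe gt_eqF//= => /eqP.
  exact.
by move=> /(ae_notin nu mC); apply: filterS => x /= /contrapT.
Qed.

Lemma integral_dilation_inv (F : X -> \bar R) : (forall x, 0 <= F x)%E ->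
  measurable_fun setT F ->
  (\int[nu]_x (F (D' x) * (\1_X0 x)%:E) = s%:E * \int[nu]_x F x)%E.
Proof.
move=> F0 mF; pose H x := (F (D' x) * (\1_X0 x)%:E)%E.
have H0 x : (0 <= H x)%E by rewrite mule_ge0.
have mH : measurable_fun setT H.
  apply: emeasurable_funM; first exact: measurableT_comp.
  exact/measurable_EFinP.
have -> : (\int[nu]_x F x = \int[nu]_x H (D x))%E.
  apply: ae_eq_integral => //; first exact: measurableT_comp.
  apply: filterS2 dilation_in (dilationK dil) => x h1 h2 _.
  by rewrite /H h2 indicE mem_set// mule1.
rewrite (integral_is_RN_density mD (dilation_density dil) H0 mH).
rewrite -ge0_integralZl//; last 3 first.
- apply: emeasurable_funM => //; apply/measurable_EFinP.
  exact: measurable_funM.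
- by move=> x _; rewrite mule_ge0// lee_fin mulr_ge0// invr_ge0 ltW.
- by rewrite lee_fin ltW.
apply: eq_integral => x _; rewrite muleA -EFinM mulrA divff ?gt_eqF// mul1r.
rewrite /H indicE; case: (x \in X0); first by rewrite mul1e.
by rewrite mule0 mul0e.
Qed.

Lemma measure_dilation_inv A : measurable A ->
  (nu (D' @^-1` A `&` X0) = s%:E * nu A)%E.
Proof.
move=> mA.
have mDA : measurable (D' @^-1` A) by rewrite -[_ @^-1` _]setTI; exact: mD'.
rewrite -[X in nu X]setIT -integral_indic//; last exact: measurableI.
transitivity (\int[nu]_x ((\1_A (D' x))%:E * (\1_X0 x)%:E))%E.
  by apply: eq_integral => x _; rewrite indicI EFinM.
rewrite (@integral_dilation_inv (fun x => (\1_A x)%:E)).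
- by rewrite integral_indic// setIT.
- by move=> x; rewrite lee_fin.
- exact/measurable_EFinP.
Qed.

Lemma ae_dilation_inv (Q : X -> Prop) : {ae nu, forall x, Q x} ->
  {ae nu, forall x, X0 x -> Q (D' x)}.
Proof.
move=> [A [mA A0 QA]].
have mDA : measurable (D' @^-1` A) by rewrite -[_ @^-1` _]setTI; exact: mD'.
exists (D' @^-1` A `&` X0); split; first exact: measurableI.
  have A0' : nu A = 0%E by [].
  by apply: etrans (measure_dilation_inv mA) _; rewrite A0' mule0.
by move=> x /= /not_implyP[X0x nQ]; split => //; exact: QA.
Qed.

Lemma measure_dilation_range : nu X0 = s%:E.
Proof.
have := measure_preimage_dilation measurableT.
by rewrite preimage_setT probability_setT mule1 setTI.
Qed.

End DilationTheory.

Section StandardDilation.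
Context (f : X -> R) (g : R -> X).
Hypotheses (mf : measurable_fun setT f) (mg : measurable_fun setT g)
  (fnu : forall B : set R, measurable B ->
     nu (f @^-1` B) = lambda (B `&` `[0%R, 1%R]%classic))
  (gf : {ae nu, forall x, g (f x) = x})
  (fg : {ae lambda, forall y, `[0%R, 1%R]%classic y -> f (g y) = y}).

(** The law of [f] is dominated by Lebesgue measure, whose null sets are stable under scaling. This
    allows [fg] to be used at the point [t * f x]. *)
Lemma ae_standard_scale (t : R) (Q : R -> Prop) : 0 < t ->
  {ae lambda, forall y, Q y} -> {ae nu, forall x, Q (t * f x)}.
Proof.
move=> t0 [A [mA A0 QA]].
have mt : measurable ((fun y => t * y) @^-1` A).
  rewrite -[_ @^-1` _]setTI.
  have : measurable_fun setT (fun y : R => t * y) by exact: measurable_funM.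
  exact.
exists ((fun x => t * f x) @^-1` A); split.
- have : measurable_fun setT (fun x => t * f x) by exact: measurable_funM.
  by move=> /(_ measurableT A mA); rewrite setTI.
- apply/eqP; rewrite eq_le measure_ge0 andbT.
  rewrite -[X in nu X]/(f @^-1` ((fun y => t * y) @^-1` A)) fnu//.
  apply: (@le_trans _ _ (lambda ((fun y => t * y) @^-1` A))).
    by apply: le_measure; rewrite ?inE//; exact: measurableI.
  by rewrite lebesgue_measure_scale// A0 mule0.
- by move=> x /= h; exact: QA.
Qed.

(** Excluding the endpoint 1 puts almost every point into [standard_range s] once [s] is close
    enough to 1. *)
Lemma ae_standard_itv : {ae nu, forall x, 0 <= f x < 1}.
Proof.
have mI : measurable (f @^-1` ~` `[0, 1[%classic).
  by rewrite -[_ @^-1` _]setTI; apply: mf => //; exact: measurableC.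
have : nu (f @^-1` ~` `[0, 1[%classic) = 0%E.
  rewrite fnu; last exact: measurableC.
  apply/eqP; rewrite eq_le measure_ge0 andbT -(lebesgue_measure_set1 (1 : R)).
  apply: le_measure; rewrite ?inE//; first by apply: measurableI => //; exact: measurableC.
  move=> y [/= /negP]; rewrite !in_itv/= negb_and -leNgt -ltNge => h /andP[h0 h1].
  apply/eqP; rewrite eq_le h1/=; move: h; rewrite leNgt => /orP[|//].
  by rewrite ltNge h0.
by move=> /(ae_notin nu mI); apply: filterS => x /= /contrapT; rewrite in_itv.
Qed.

(** The model is multiplication by [s] from [0, 1] onto [0, s], transported through the coordinate
    [f]. *)
Definition standard_range (s : R) := [set x | f x <= s].
Definition standard_dil (s : R) x := g (s * f x).
Definition standard_dil_inv (s : R) x := g (s^-1 * f x).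

Lemma standard_dilation (s : R) : 0 < s < 1 ->
  dilation s (standard_range s) (standard_dil s) (standard_dil_inv s).
Proof.
move=> /andP[s0 s1].
have s0' : 0 < s^-1 by rewrite invr_gt0.
have mX0 : measurable (standard_range s).
  rewrite -[X in measurable X]setTI; exact: measurable_fun_ler.
have mscl (t : R) : measurable_fun setT (fun x => g (t * f x)).
  by apply: measurableT_comp => //; exact: measurable_funM.
split => //.
- exact: mscl.
- exact: mscl.
- split.
  + exact: measurable_funM.
  + by move=> x; rewrite mulr_ge0// ltW.
  + move=> B mB.
    have mgB : measurable (g @^-1` B) by rewrite -[_ @^-1` _]setTI; exact: mg.
    have mscale' : measurable ((fun y => s * y) @^-1` (g @^-1` B)).
      rewrite -[_ @^-1` _]setTI.
      have : measurable_fun setT (fun y : R => s * y) by exact: measurable_funM.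
      exact.
    under eq_integral do rewrite EFinM.
    rewrite ge0_integralZl//; last 2 first.
      exact/measurable_EFinP.
      by rewrite lee_fin ltW.
    rewrite integral_indic// -[LHS]/(nu (f @^-1` ((fun y => s * y) @^-1` (g @^-1` B)))).
    rewrite fnu//.
    (* For [0 <= s * y], the bound [s * y <= s] is equivalent to [y] lying in [0, 1]; the set
       becomes a full preimage under scaling. *)
    have -> : (fun y => s * y) @^-1` (g @^-1` B) `&` `[0, 1]%classic =
      (fun y => s * y) @^-1` ((g @^-1` B `&` `]-oo, s]%classic) `&` `[0, 1]%classic).
      apply/seteqP; split => y /=; rewrite !in_itv/=.
        move=> [h /andP[y0 y1]]; split; first split => //.
          by rewrite -[leRHS]mulr1 ler_pM2l.
        by rewrite (mulr_ge0 (ltW s0) y0) mulr_ile1// ltW.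
      move=> [[h h1] /andP[h2 h3]]; split => //.
      by rewrite -(pmulr_rge0 _ s0) h2 -(ler_pM2l s0) mulr1.
    rewrite lebesgue_measure_scale//; last first.
      by apply: measurableI => //; exact: measurableI.
    rewrite -fnu; last exact: measurableI.
    congr (_ * _)%E; apply: ae_measure_eq.
    * by rewrite -[_ @^-1` _]setTI; apply: mf => //; exact: measurableI.
    * exact: measurableI.
    * by apply: filterS gf => x h; rewrite /standard_range/= h in_itv/=; split => -[].
- apply: filterS3 gf ae_standard_itv (ae_standard_scale s0 fg) => x h1 /andP[h2 h3] h4.
  rewrite /standard_dil_inv /standard_dil h4.
    by rewrite mulrA mulVf ?gt_eqF// mul1r.
  by rewrite /= in_itv/= (mulr_ge0 (ltW s0) h2) mulr_ile1// ltW.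
- apply: filterS3 gf ae_standard_itv (ae_standard_scale s0' fg) => x h1 /andP[h2 h3] h4 h5.
  rewrite /standard_dil_inv /standard_dil h4.
    by rewrite mulrA divff ?gt_eqF// mul1r.
  by rewrite /= in_itv/= (mulr_ge0 (ltW s0') h2) ler_pdivrMl// mulr1.
Qed.

End StandardDilation.
End Dilation.

(** * Dilations with ratio tending to 1 *)

Section StandardDilationCvg.
Context {R : realType} {d : measure_display} {X : measurableType d}
  (nu : probability X R).
Local Notation lambda := (@lebesgue_measure R).
Context (f : X -> R) (g : R -> X).
Hypotheses (mf : measurable_fun setT f) (mg : measurable_fun setT g)
  (fnu : forall B : set R, measurable B ->
     nu (f @^-1` B) = lambda (B `&` `[0%R, 1%R]%classic))
  (gf : {ae nu, forall x, g (f x) = x})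
  (fg : {ae lambda, forall y, `[0%R, 1%R]%classic y -> f (g y) = y}).

Lemma ge0_integral_standard (F : R -> \bar R) :
  (forall y, 0 <= F y)%E -> measurable_fun setT F ->
  (\int[nu]_x F (f x) = \int[lambda]_(y in `[0%R, 1%R]%classic) F y)%E.
Proof.
move=> F0 mF.
have mI : measurable (f @^-1` `[0, 1]%classic).
  by rewrite -[_ @^-1` _]setTI; exact: mf.
have mf' : @measurable_fun _ _ X (measurableTypeR R) setT f by exact: mf.
pose f' : {mfun X >-> measurableTypeR R} :=
  HB.pack (f : X -> measurableTypeR R) (isMeasurableFun.Build _ _ _ _ _ mf').
have -> : (\int[lambda]_(y in `[0%R, 1%R]%classic) F y =
    \int[distribution nu f']_(y in `[0%R, 1%R]%classic) F y)%E.
  apply: eq_measure_integral => A mA A01.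
  rewrite -[RHS]/(nu (f @^-1` A)) fnu//.
  by congr (lambda _); apply/esym/setIidPl.
rewrite ge0_integral_pushforward//; last exact: measurable_funTS.
rewrite [RHS]integral_mulindic; apply: ae_eq_integral => //.
- exact: measurableT_comp.
- apply: emeasurable_funM; first exact: measurableT_comp.
  exact/measurable_EFinP.
- apply: filterS (ae_standard_itv mf fnu) => x /andP[h1 h2] _.
  by rewrite indicE mem_set ?mule1//= in_itv/= h1 ltW.
Qed.

(** Density of continuous functions in L1 of [0, 1], read through the coordinate [f]; for these
    functions the effect of a dilation close to the identity is visible pointwise. *)
Lemma continuous_approximation (h : X -> R) (e : R) : 0 < e ->
  nu.-integrable setT (EFin \o h) ->
  exists2 k : R -> R, continuous k &
    (\int[nu]_x (`|h x - k (f x)|)%:E < e%:E)%E.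
Proof.
move=> e0 hi.
have mh : measurable_fun setT h by apply/measurable_EFinP/(measurable_int nu).
have mhg : measurable_fun setT (h \o g) by exact: measurableT_comp.
have mI : measurable (`[0, 1]%classic : set R) by [].
have [||k_ [ck _ klim]] := @approximation_continuous_integrable R `[0, 1]%classic (h \o g) mI.
- by rewrite /= lebesgue_measure_itv/= lte01 oppr0 adde0 ltry.
- apply/integrableP; split.
    by apply/measurable_EFinP; exact: measurable_funTS.
  rewrite -(@ge0_integral_standard (fun y => `|(EFin \o (h \o g)) y|)%E)//; last first.
    by apply: measurableT_comp => //; exact/measurable_EFinP.
  move/integrableP: (hi) => [_]; apply: le_lt_trans.
  rewrite le_eqVlt; apply/orP; left; apply/eqP; apply: ae_eq_integral => //.
  + apply: measurableT_comp => //; apply/measurable_EFinP.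
    by apply: measurableT_comp => //.
  + by apply: measurableT_comp => //; exact/measurable_EFinP.
  + by apply: filterS gf => x /= -> _.
have mk n : measurable_fun setT (k_ n) by exact: continuous_measurable_fun.
have dE n : (\int[nu]_x (`|h x - k_ n (f x)|)%:E =
    \int[lambda]_(z in `[0%R, 1%R]%classic) `|((h \o g) z - k_ n z)%:E|)%E.
  rewrite -(@ge0_integral_standard (fun z => `|((h \o g) z - k_ n z)%:E|)%E)//; last first.
    by apply: measurableT_comp => //; apply/measurable_EFinP; exact: measurable_funB.
  apply: ae_eq_integral => //.
  + apply/measurable_EFinP; apply: measurableT_comp => //; apply: measurable_funB => //.
    exact: measurableT_comp.
  + apply: measurableT_comp => //; apply/measurable_EFinP; apply: measurable_funB.
      by apply: measurableT_comp => //.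
    exact: measurableT_comp.
  + by apply: filterS gf => x /= -> _.
move: klim => /fine_cvgP[] [m _ fin] /cvgrPdist_lt /(_ e e0) [p _].
move=> /(_ (p + m)%N (leq_addr _ _)) /=; rewrite sub0r normrN => hp.
exists (k_ (p + m)%N) => //; rewrite dE.
rewrite -[ltLHS]fineK; last by apply: fin => /=; exact: leq_addl.
by rewrite lte_fin; apply: le_lt_trans (ler_norm _) hp.
Qed.

(** The factor 1/2 keeps the ratio positive at [n = 0]. *)
Definition dil_ratio (n : nat) : R := 1 - 2^-1 * n.+1%:R^-1.

Lemma dil_ratio_itv n : 0 < dil_ratio n < 1.
Proof.
have h1 : 0 < n.+1%:R^-1 :> R by rewrite invr_gt0.
have h2 : n.+1%:R^-1 <= 1 :> R by rewrite invf_le1 ?ler1n.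
by rewrite /dil_ratio; move: (n.+1%:R^-1) h1 h2 => t h1 h2; apply/andP; split; lra.
Qed.

Lemma dil_ratio_cvg : dil_ratio @ \oo --> (1 : R).
Proof.
have : dil_ratio @ \oo --> (1 - 2^-1 * 0 : R).
  apply: cvgB; first exact: cvg_cst.
  by apply: cvgM; [exact: cvg_cst|exact: cvg_harmonic].
by rewrite mulr0 subr0.
Qed.

(** Dominated convergence, with the maximum of |k| on [0, 1] as bound: the indicator removes the
    arguments that the dilation pushes beyond 1. *)
Lemma continuous_dilation_cvg (k : R -> R) : continuous k ->
  (\int[nu]_x (`|k ((dil_ratio n)^-1 * f x) * \1_(standard_range f (dil_ratio n)) x
     - k (f x)|)%:E)%E @[n --> \oo] --> 0%E.
Proof.
move=> ck.
have mk : measurable_fun setT k by exact: continuous_measurable_fun.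
have [M hM] : exists M, forall y, 0 <= y <= 1 -> `|k y| <= M.
  have [|z _ hz] := @EVT_max R (fun y => `|k y|) 0 1 ler01.
    apply: continuous_subspaceT => y.
    by apply: continuous_comp; [exact: ck|exact: norm_continuous].
  by exists `|k z| => y hy; apply: hz; rewrite in_itv.
have M0 : 0 <= M by apply: le_trans (hM 0 _); rewrite ?normr_ge0// lexx ler01.
pose F n x : \bar R := (k ((dil_ratio n)^-1 * f x) * \1_(standard_range f (dil_ratio n)) x)%:E.
have mF n : measurable_fun setT (F n).
  apply/measurable_EFinP; apply: measurable_funM.
    by apply: measurableT_comp => //; exact: measurable_funM.
  apply: measurable_indic; rewrite -[X in measurable X]setTI.
  exact: measurable_fun_ler.
have [||||_ + _] := @dominated_convergence _ _ _ nu setT measurableT F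
  (fun x => (k (f x))%:E) (cst M%:E) mF.
- by apply/measurable_EFinP; exact: measurableT_comp.
- apply: filterS (ae_standard_itv mf fnu) => x /andP[x0 x1] _.
  apply: cvg_EFin; first exact: nearW.
  have kc : k ((dil_ratio n)^-1 * f x) @[n --> \oo] --> k (f x).
    apply: continuous_cvg; first exact: ck.
    have : (dil_ratio n)^-1 * f x @[n --> \oo] --> 1^-1 * f x.
      apply: cvgM; last exact: cvg_cst.
      by apply: cvgV; [exact: oner_neq0|exact: dil_ratio_cvg].
    by rewrite invr1 mul1r.
  apply: cvg_trans kc; apply: near_eq_cvg.
  have [N _ hN] := @cvgr_ge _ _ _ _ _ _ dil_ratio_cvg _ x1; exists N => // n /hN hn.
  by rewrite /= indicE mem_set ?mulr1.
- exact: finite_measure_integrable_cst.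
- apply: filterS (ae_standard_itv mf fnu) => x /andP[x0 x1] n _.
  rewrite lee_fin indicE; case: (boolP (x \in _)); rewrite ?mulr0 ?normr0 ?mulr1//.
  rewrite inE => /= h; have /andP[s0 s1] := dil_ratio_itv n.
  have s0' : 0 <= (dil_ratio n)^-1 by rewrite invr_ge0 ltW.
  by apply: hM; rewrite (mulr_ge0 s0' x0) ler_pdivrMl// mulr1.
apply: cvg_trans; apply: near_eq_cvg; apply: nearW => n /=.
by apply: eq_integral => x _.
Qed.

(** Three thirds: the approximation error of [h] by [k o f], the same error moved by [D'], which the
    dilation multiplies by [s < 1], and the continuous case. *)
Lemma standard_dilation_cvg (h : X -> R) (e : R) : 0 < e ->
  nu.-integrable setT (EFin \o h) ->
  \forall n \near \oo,
    (\int[nu]_x (`|h (standard_dil_inv f g (dil_ratio n) x) *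
       \1_(standard_range f (dil_ratio n)) x - h x|)%:E < e%:E)%E.
Proof.
move=> e0 hi; have e3 : 0 < e / 3 by rewrite divr_gt0.
have [k ck hk] := continuous_approximation e3 hi.
have mh : measurable_fun setT h by apply/measurable_EFinP/(measurable_int nu).
have mk : measurable_fun setT k by exact: continuous_measurable_fun.
move: (continuous_dilation_cvg ck) => /fine_cvgP[] fin /cvgrPdist_lt /(_ _ e3) cvgk.
apply: filterS2 fin cvgk => n finn cvgn.
set s := dil_ratio n; have sitv := dil_ratio_itv n.
have dil := standard_dilation mf mg fnu gf fg sitv; rewrite -/s in dil.
set X0 := standard_range f s; set D' := standard_dil_inv f g s.
have mX0 : measurable X0 := measurable_dilation_range dil.
have mD' : measurable_fun setT D' := measurable_dilation_inv dil.
pose p x : R := `|h x - k (f x)|.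
pose q x : R := `|k (s^-1 * f x) * \1_X0 x - k (f x)|.
have p0 x : 0 <= p x by exact: normr_ge0.
have q0 x : 0 <= q x by exact: normr_ge0.
have pD0 x : 0 <= p (D' x) * \1_X0 x by rewrite mulr_ge0.
have mp : measurable_fun setT p.
  apply: measurableT_comp => //; apply: measurable_funB => //.
  exact: measurableT_comp.
have mq : measurable_fun setT q.
  apply: measurableT_comp => //; apply: measurable_funB; last exact: measurableT_comp.
  apply: measurable_funM => //; apply: measurableT_comp => //.
  exact: measurable_funM.
have mpD : measurable_fun setT (fun x => p (D' x) * \1_X0 x).
  by apply: measurable_funM => //; exact: measurableT_comp.
apply: (@le_lt_trans _ _ (\int[nu]_x ((p (D' x) * \1_X0 x)%:E + ((q x)%:E + (p x)%:E)))%E).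
  apply: ae_ge0_le_integral => //.
  - apply/measurable_EFinP; apply: measurableT_comp => //; apply: measurable_funB => //.
    by apply: measurable_funM => //; exact: measurableT_comp.
  - by move=> x _; rewrite -!EFinD lee_fin addr_ge0// addr_ge0.
  - by do 2 (apply: emeasurable_funD; first exact/measurable_EFinP); exact/measurable_EFinP.
  have s0' : 0 < s^-1 by rewrite invr_gt0; have /andP[] := sitv.
  apply: filterS2 (ae_standard_itv mf fnu) (ae_standard_scale mf fnu s0' fg) => x /andP[x0 x1] hx _.
  rewrite -!EFinD lee_fin /q /p indicE.
  case: (boolP (x \in X0)) => [|_]; rewrite ?mulr1 ?mulr0.
    rewrite inE => /= xs.
    have -> : f (D' x) = s^-1 * f x.
      apply: hx; rewrite /= in_itv/= (mulr_ge0 (ltW s0') x0) ler_pdivrMl ?mulr1//.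
      by have /andP[] := sitv.
    have -> : h (D' x) - h x = (h (D' x) - k (s^-1 * f x)) +
      ((k (s^-1 * f x) - k (f x)) + (k (f x) - h x)) by ring.
    rewrite [X in _ <= _ + (_ + X)]distrC.
    by rewrite (le_trans (ler_normD _ _))// lerD2l ler_normD.
  rewrite [leRHS]add0r (distrC (h x) (k (f x))).
  rewrite [leLHS](_ : _ = `|(0 - k (f x)) + (k (f x) - h x)|); first exact: ler_normD.
  by congr (`|_|); ring.
rewrite ge0_integralD//; last 4 first.
- by move=> x _; rewrite lee_fin.
- exact/measurable_EFinP.
- by move=> x _; rewrite -EFinD lee_fin addr_ge0.
- by apply: emeasurable_funD; exact/measurable_EFinP.
rewrite ge0_integralD//; last 4 first.
- by move=> x _; rewrite lee_fin.
- exact/measurable_EFinP.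
- by move=> x _; rewrite lee_fin.
- exact/measurable_EFinP.
have -> : e = e / 3 + (e / 3 + e / 3) by field.
rewrite !EFinD; apply: lteD; last apply: lteD => //.
  under eq_integral do rewrite EFinM.
  rewrite (integral_dilation_inv dil (F := EFin \o p)) => [||]; last exact/measurable_EFinP.
    apply: le_lt_trans hk; rewrite -[leRHS]mul1e; apply: lee_wpmul2r.
      by apply: integral_ge0 => x _; rewrite lee_fin.
    by rewrite lee_fin ltW//; have /andP[] := sitv.
  by move=> x; rewrite lee_fin.
move: cvgn => /=; rewrite sub0r normrN => hp.
have qfin : (\int[nu]_x (q x)%:E)%E \is a fin_num := finn.
rewrite -(fineK qfin) lte_fin.
exact: (le_lt_trans (ler_norm _) hp).
Qed.

End StandardDilationCvg.

(** * Gluing an action to the identity *)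

Section Glue.
Context {R : realType} {d : measure_display} {X : measurableType d}
  (nu : probability X R) {G : groupType}.
Context (s : R) (X0 : set X) (D D' : X -> X) (dil : dilation nu s X0 D D').
Context (mu : G -> R) (a : G -> X -> X) (mu1 : probability_on mu)
  (amu : A_mu nu mu a).

Definition glued (g : G) (x : X) : X :=
  if x \in X0 then D (a g (D' x)) else x.

Let mD := measurable_dilation dil.
Let mD' := measurable_dilation_inv dil.
Let mX0 := measurable_dilation_range dil.
Let s0 := dilation_gt0 dil.
Let aP : nonsingular_action nu a. Proof. by case: amu. Qed.
Let ma g : measurable_fun setT (a g). Proof. exact: (measurable_action aP). Qed.

Let mpre (T : X -> X) B : measurable_fun setT T -> measurable B ->
  measurable (T @^-1` B).
Proof. by move=> mT mB; rewrite -[_ @^-1` _]setTI; exact: mT. Qed.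

Lemma glue_preimage g B : glued g @^-1` B =
  (D' @^-1` (a g @^-1` (D @^-1` B)) `&` X0) `|` (B `\` X0).
Proof.
apply/seteqP; split=> x; rewrite /glued /=.
  by case: ifPn; rewrite ?inE ?notin_setE => ? ?; [left|right].
by move=> [[h1 h2]|[h1 h2]]; [rewrite mem_set|rewrite memNset].
Qed.

Lemma measurable_glue g : measurable_fun setT (glued g).
Proof.
move=> _ B mB; rewrite setTI glue_preimage; apply: measurableU.
  by apply: measurableI => //; do 3 apply: mpre => //.
exact: measurableD.
Qed.

Lemma measure_glue_preimage g B : measurable B ->
  (nu (glued g @^-1` B) = s%:E * nu (a g @^-1` (D @^-1` B)) + nu (B `\` X0))%E.
Proof.
move=> mB; have maD : measurable (a g @^-1` (D @^-1` B)) by do 2 apply: mpre => //.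
rewrite glue_preimage measureU; last 3 first.
- by apply: measurableI => //; exact: mpre.
- exact: measurableD.
- by apply/seteqP; split=> // x [[_ h] [_ h']].
by congr (_ + _)%E; exact: (measure_dilation_inv dil maD).
Qed.

Lemma measure_split_dilation B : measurable B ->
  (nu B = s%:E * nu (D @^-1` B) + nu (B `\` X0))%E.
Proof.
move=> mB; have -> : (nu B = nu (B `\` X0) + nu (B `&` X0))%E := measureDI nu mB mX0.
by rewrite (measure_preimage_dilation dil mB) addeC.
Qed.

Lemma glue_nonsingular g : nonsingular nu (glued g).
Proof.
split; first exact: measurable_glue.
move=> B mB; have [_ na] := action_nonsingular aP g.
have key (C : set X) : (s%:E * nu C + nu (B `\` X0) = 0)%E <->
    nu C = 0%E /\ nu (B `\` X0) = 0%E.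
  split=> [|[-> ->]]; last by rewrite mule0 adde0.
  move=> /eqP; rewrite padde_eq0 ?mule_ge0 ?lee_fin ?(ltW s0)//.
  by rewrite mule_eq0 eqe gt_eqF//= => /andP[/eqP -> /eqP ->].
have naD := na _ (mpre mD mB).
rewrite measure_glue_preimage// (measure_split_dilation mB).
by split => /key[e1 e2]; apply/key; split => //; apply/naD.
Qed.

Lemma glue_action : nonsingular_action nu glued.
Proof.
have [_ aM a1] := aP.
split; first exact: glue_nonsingular.
  move=> g h.
  have e1 := ae_dilation_inv dil (aM g h).
  have e2 := ae_dilation_inv dil (ae_preimage (action_null_preserving aP h) (dilationK dil)).
  have e3 := ae_dilation_inv dil (ae_preimage (action_null_preserving aP h) (dilation_in dil)).
  apply: filterS3 e1 e2 e3 => x e1 e2 e3; rewrite /glued.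
  case: ifPn => [|xX0]; last by rewrite (negbTE xX0).
  by rewrite inE => xX0; rewrite mem_set ?e1 ?e2//; exact: e3.
apply: filterS2 (ae_dilation_inv dil a1) (dilationVK dil) => x e1 e2.
by rewrite /glued; case: ifPn => //; rewrite inE => xX0; rewrite e1// e2.
Qed.

Lemma glue_A_mu : A_mu nu mu glued.
Proof.
split; first exact: glue_action.
move=> B mB; have [mu0 mus] := mu1; have [_ stat] := amu.
have mDB : measurable (D @^-1` B) by exact: mpre.
transitivity (\esum_(g in [set: G]) ((mu g)%:E * (s%:E * nu (a g @^-1` (D @^-1` B))) +
    (mu g)%:E * nu (B `\` X0)))%E.
  apply: eq_esum => g _; rewrite measure_glue_preimage// ge0_muleDr//.
  by rewrite mule_ge0// lee_fin ltW.
rewrite esumD; last 2 first.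
- by move=> g _; rewrite !mule_ge0 ?lee_fin// ltW.
- by move=> g _; rewrite mule_ge0// lee_fin.
under eq_esum do rewrite muleCA.
rewrite esumZl ?(ltW s0)//; last by move=> g; rewrite mule_ge0// lee_fin.
rewrite stat//.
have mBX : measurable (B `\` X0) by exact: measurableD.
have bfin : nu (B `\` X0) \is a fin_num by exact: fin_num_measure.
under [X in (_ + X)%E]eq_esum do rewrite muleC -(fineK bfin).
rewrite esumZl ?fine_ge0// mus mule1 fineK//.
by rewrite -measure_split_dilation.
Qed.

Let rho g := RN_density nu (a g).
Let rho_ge0 g x : 0 <= rho g x.
Proof. exact/RN_density_ge0/(action_nonsingular aP). Qed.
Let mrho g : measurable_fun setT (rho g).
Proof. exact/measurable_RN_density/(action_nonsingular aP). Qed.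
Let mind (A : set X) : measurable A -> measurable_fun setT (\1_A : X -> R).
Proof. exact: measurable_indic. Qed.

(** The factors [s] and [s^-1] of the two dilations cancel, leaving on [X0] the density of [a g]
    moved by [D']. *)
Lemma glue_density g : is_RN_density nu (glued g)
  (fun x => rho g (D' x) * \1_X0 x + \1_(~` X0) x).
Proof.
have mr : measurable_fun setT (fun x => rho g (D' x) * \1_X0 x).
  by apply: measurable_funM; [exact: measurableT_comp|exact: mind].
split.
- by apply: measurable_funD => //; apply: mind; exact: measurableC.
- by move=> x; rewrite addr_ge0// mulr_ge0.
move=> B mB; rewrite measure_glue_preimage//.
have mDB : measurable (D @^-1` B) by exact: mpre.
under eq_integral do rewrite EFinD.
rewrite ge0_integralD//; last 3 first.
- by move=> x _; rewrite lee_fin mulr_ge0.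
- exact/measurable_EFinP/measurable_funTS.
- by apply/measurable_EFinP/measurable_funTS; apply: mind; exact: measurableC.
congr (_ + _)%E; last first.
  by rewrite integral_indic//; [rewrite setIC setDE|exact: measurableC].
rewrite [RHS]integral_mulindic.
have [_ _ ->//] := RN_densityP (action_nonsingular aP g).
rewrite [X in (_ * X)%E]integral_mulindic -/(rho g).
pose F x := ((rho g x)%:E * (\1_(D @^-1` B) x)%:E)%E.
have F0 x : (0 <= F x)%E by rewrite mule_ge0// lee_fin.
have mF : measurable_fun setT F.
  by apply: emeasurable_funM; apply/measurable_EFinP => //; exact: mind.
rewrite -[LHS](integral_dilation_inv dil F0 mF) /F.
apply: ae_eq_integral => //.
- apply: emeasurable_funM; last by apply/measurable_EFinP; exact: mind.
  apply: emeasurable_funM; first by apply/measurable_EFinP; exact: measurableT_comp.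
  by apply/measurable_EFinP; apply: measurableT_comp => //; exact: mind.
- by apply: emeasurable_funM; apply/measurable_EFinP => //; exact: mind.
apply: filterS (dilationVK dil) => x h _.
rewrite -!EFinM; congr EFin; rewrite !indicE.
case: (boolP (x \in X0)); last by rewrite !mulr0 mul0r.
rewrite inE => /h hx; rewrite !mulr1; congr (_ * _%:R); congr nat_of_bool.
by apply/idP/idP; rewrite !inE /= hx.
Qed.

Lemma U1_glue g A : {ae nu, forall x, U1 nu (glued g) (glued g^-1%g) A x =
  rho g (D' x) * \1_A (D (a g^-1%g (D' x))) * \1_X0 x + \1_(~` X0) x * \1_A x}.
Proof.
have := RN_density_unique (RN_densityP (glue_nonsingular g)) (glue_density g).
apply: filterS => x h; rewrite /U1 h /glued indicC /=.
by case: (boolP (x \in X0)) => h'; rewrite !indicE ?h' /=; rewrite ?(negbTE h') /=; ring.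
Qed.

Lemma U1_glue_fixed g :
  {ae nu, forall x, U1 nu (glued g) (glued g^-1%g) (~` X0) x = \1_(~` X0) x}.
Proof.
have e3 := ae_dilation_inv dil
  (ae_preimage (action_null_preserving aP g^-1%g) (dilation_in dil)).
apply: filterS2 (U1_glue g (~` X0)) e3 => x -> h.
rewrite !indicE; case: (boolP (x \in X0)) => xX0; last first.
  by rewrite mulr0 add0r in_setC xX0 mulr1.
rewrite (_ : _ \in ~` X0 = false) ?mulr0 ?mul0r ?add0r; last first.
  by apply: memNset => /=; apply; apply: h; rewrite inE in xX0.
by rewrite in_setC xX0 mul0r.
Qed.

Let err (h : X -> R) : \bar R := (\int[nu]_x (`|h (D' x) * \1_X0 x - h x|)%:E)%E.

(** On [X0] the difference is split at [h (D' x)]: the first part is the effect of [D] on [\1_A],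
    the second that of [D'] on [h]. Off [X0] it is at most [h x + 1], and the 1 is the error of the
    constant. *)
Lemma L1dist_glue g A : measurable A ->
  (L1dist nu (U1 nu (glued g) (glued g^-1%g) A) (U1 nu (a g) (a g^-1%g) A) <=
   err (\1_A) + (err (U1 nu (a g) (a g^-1%g) A) + err (cst 1%R)))%E.
Proof.
move=> mA; rewrite /L1dist.
pose h := U1 nu (a g) (a g^-1%g) A.
pose h' x := rho g x * \1_A (D (a g^-1%g x)).
have mh : measurable_fun setT h.
  by apply: measurable_funM; [exact: mrho|exact: (measurableT_comp (mind mA) (ma _))].
have mh' : measurable_fun setT h'.
  apply: measurable_funM => //; apply: (measurableT_comp (mind mA)).
  exact: measurableT_comp.
pose p x : R := `|h' x - h x|.
pose q x : R := `|h (D' x) * \1_X0 x - h x|.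
pose r x : R := `|cst 1 (D' x) * \1_X0 x - cst 1 x|.
have mp : measurable_fun setT p by apply: measurableT_comp => //; exact: measurable_funB.
have mq : measurable_fun setT q.
  apply: measurableT_comp => //; apply: measurable_funB => //.
  by apply: measurable_funM; [exact: measurableT_comp|exact: mind].
have mr : measurable_fun setT r.
  apply: measurableT_comp => //; apply: measurable_funB => //.
  by apply: measurable_funM => //; exact: mind.
have p0 x : 0 <= p x by exact: normr_ge0.
have q0 x : 0 <= q x by exact: normr_ge0.
have r0 x : 0 <= r x by exact: normr_ge0.
have pD0 x : 0 <= p (D' x) * \1_X0 x by rewrite mulr_ge0.
have mpD : measurable_fun setT (fun x => p (D' x) * \1_X0 x).
  by apply: measurable_funM; [exact: measurableT_comp|exact: mind].
apply: (@le_trans _ _ (\int[nu]_x ((p (D' x) * \1_X0 x)%:E + ((q x)%:E + (r x)%:E)))%E).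
  apply: ae_ge0_le_integral => //.
  - apply/measurable_EFinP; apply: measurableT_comp => //; apply: measurable_funB => //.
    apply: measurable_funM.
      exact/measurable_RN_density/glue_nonsingular.
    by apply: (measurableT_comp (mind mA)); exact: measurable_glue.
  - by move=> x _; rewrite -!EFinD lee_fin addr_ge0// addr_ge0.
  - by do 2 (apply: emeasurable_funD; first exact/measurable_EFinP); exact/measurable_EFinP.
  apply: filterS (U1_glue g A) => x -> _.
  rewrite -/h -!EFinD lee_fin -/(h' (D' x)) /p /q /r indicC /= mul1r.
  rewrite !indicE; case: (boolP (x \in X0)) => xX0 /=.
    rewrite !mulr1 mul0r addr0 subrr normr0 addr0.
    have -> : h' (D' x) - h x = (h' (D' x) - h (D' x)) + (h (D' x) - h x) by ring.
    exact: ler_normD.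
  rewrite !mulr0 !add0r mul1r !normrN normr1.
  apply: (le_trans (ler_normB _ _)).
  by rewrite [leLHS]addrC lerD2l; case: (x \in A); rewrite ?normr1 ?normr0.
rewrite ge0_integralD//; last 4 first.
- by move=> x _; rewrite lee_fin.
- exact/measurable_EFinP.
- by move=> x _; rewrite -EFinD lee_fin addr_ge0.
- by apply: emeasurable_funD; exact/measurable_EFinP.
rewrite ge0_integralD//; last 4 first.
- by move=> x _; rewrite lee_fin.
- exact/measurable_EFinP.
- by move=> x _; rewrite lee_fin.
- exact/measurable_EFinP.
rewrite leeD2r//.
(* The density of [a g] turns the integral of [p] into that of [k], and substituting [D'] turns the
   latter, times [s], into a part of [err (\1_A)]. *)
pose k x : R := `|\1_A (D x) - \1_A x|.
have mk : measurable_fun setT k.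
  by apply: measurableT_comp => //; apply: measurable_funB;
    [exact: measurableT_comp (mind mA) mD|exact: mind].
have k0 x : (0 <= (k x)%:E)%E by rewrite lee_fin normr_ge0.
under eq_integral do rewrite EFinM.
rewrite (integral_dilation_inv dil (F := EFin \o p)); last 2 first.
- by move=> x; rewrite lee_fin.
- exact/measurable_EFinP.
have -> : (\int[nu]_x (EFin \o p) x = \int[nu]_x (k x)%:E)%E.
  transitivity (\int[nu]_x ((rho g x)%:E * (k (a g^-1%g x))%:E))%E.
    apply: eq_integral => x _; rewrite /= -EFinM; congr EFin.
    by rewrite /p /h' /h /U1 -mulrBr normrM ger0_norm.
  rewrite -(integral_RN_density (action_nonsingular aP g) (F := fun x => (k (a g^-1%g x))%:E)) //.
    apply: ae_eq_integral => //.
    - apply/measurable_EFinP; apply: (measurableT_comp mk); exact: measurableT_comp.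
    - exact/measurable_EFinP.
    - by apply: filterS (actionVK aP g) => x -> _.
  by apply/measurable_EFinP; exact: measurableT_comp.
rewrite -(integral_dilation_inv dil (F := fun x => (k x)%:E)) //; last exact/measurable_EFinP.
apply: ae_ge0_le_integral => //.
- by move=> x _; rewrite mule_ge0// lee_fin.
- by apply: emeasurable_funM; apply/measurable_EFinP; [exact: measurableT_comp|exact: mind].
- apply/measurable_EFinP; apply: measurableT_comp => //; apply: measurable_funB; last exact: mind.
  by apply: measurable_funM; [exact: measurableT_comp (mind mA) mD'|exact: mind].
apply: filterS (dilationVK dil) => x h1 _.
rewrite -EFinM lee_fin /k [X in _ * X]indicE [X in _ <= `|_ * X - _|]indicE.
case: (boolP (x \in X0)) => xX0 /=; last by rewrite !mulr0.
by rewrite inE in xX0; rewrite !mulr1 h1// distrC.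
Qed.

End Glue.

(** * Accumulation of ergodic actions *)

Lemma near_seq (T : eqType) (s : seq T) (P : T -> nat -> Prop) :
  (forall t, \forall n \near \oo, P t n) ->
  \forall n \near \oo, forall t, t \in s -> P t n.
Proof.
move=> hP; elim: s => [|x s IH]; first exact: nearW.
apply: filterS2 (hP x) IH => n hx hs t.
by rewrite inE => /predU1P[->|/hs].
Qed.

Lemma countable_enum_seq (G : choiceType) : countable [set: G] ->
  exists Q : nat -> seq G, forall s : seq G, exists N : nat, forall k,
    (N <= k)%N -> {subset s <= Q k}.
Proof.
move=> /countable_injP[i injI].
have hex (j : nat) : {o : option G | forall g, i g = j -> o = Some g}.
  have [h|h] := pselect (exists g, i g = j); last first.
    by exists None => g hg; exfalso; apply: h; exists g.
  have [g hg] := cid h; exists (Some g) => g' hg'; congr Some.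
  by apply: injI; rewrite ?inE// hg hg'.
pose en j := sval (hex j).
have enE g : en (i g) = Some g by rewrite /en; case: (hex (i g)) => o /= /(_ g erefl).
exists (fun k => pmap en (iota 0 k)) => s.
exists (\max_(g <- s) (i g).+1)%N => k hk g gs.
rewrite mem_pmap; apply/mapP; exists (i g); last by rewrite enE.
by rewrite mem_iota add0n; apply: leq_trans hk; exact: leq_bigmax_seq.
Qed.

(** One factor |sqrt u - sqrt v| is bounded by sqrt u + sqrt v. *)
Lemma sqr_sub_sqrt_le {R : realType} (u v : R) : 0 <= u -> 0 <= v ->
  (Num.sqrt u - Num.sqrt v) ^+ 2 <= `|u - v|.
Proof.
move=> u0 v0; rewrite -{2}(sqr_sqrtr u0) -{2}(sqr_sqrtr v0).
have := sqrtr_ge0 u; have := sqrtr_ge0 v.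
move: (Num.sqrt u) (Num.sqrt v) => p q q0 p0.
rewrite subr_sqr normrM [X in _ * X]ger0_norm ?addr_ge0// -real_normK ?num_real//.
rewrite expr2 ler_wpM2l// -[leRHS](ger0_norm (addr_ge0 p0 q0)).
rewrite [leRHS]ger0_norm ?addr_ge0//.
by rewrite (le_trans (ler_normB _ _))// !ger0_norm.
Qed.

Section Displacement.
Context {R : realType} {d : measure_display} {X : measurableType d}
  (nu : probability X R) {G : groupType}.

Lemma integrable_U1 (c : G -> X -> X) g A : nonsingular_action nu c ->
  measurable A -> nu.-integrable setT (EFin \o U1 nu (c g) (c g^-1%g) A).
Proof.
move=> cP mA; have ng := action_nonsingular cP g.
have mr := measurable_RN_density ng.
apply: (@le_integrable _ _ _ _ _ _ _ (EFin \o RN_density nu (c g))) => //.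
- apply/measurable_EFinP; apply: measurable_funM => //.
  have mind : measurable_fun setT (\1_A : X -> R) by exact: measurable_indic.
  by apply: (measurableT_comp mind); exact: (measurable_action cP).
- move=> x _; rewrite lee_fin /U1 normrM ler_piMr// indicE.
  by case: (_ \in A); rewrite ?normr1 ?normr0.
- apply/integrableP; split; first exact/measurable_EFinP.
  under eq_integral do rewrite /= ger0_norm ?RN_density_ge0//.
  have [_ _ <-//] := RN_densityP ng.
  by rewrite preimage_setT probability_setT ltry.
Qed.

(** A nonzero [t] is subtracted only where constants are fixed, so it cancels; what remains is a
    difference of the square roots of [U1] and [\1_Z]. *)
Lemma koopman_displacement (c : G -> X -> X) (Z : set X) (t : R) g :
  nonsingular_action nu c -> measurable Z ->
  (t != 0 -> {ae nu, forall x, koopman nu c g (cst 1) x = 1}) ->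
  (\int[nu]_x ((koopman nu c g (fun y => \1_Z y - t) x - (\1_Z x - t)) ^+ 2)%:E <=
   L1dist nu (U1 nu (c g) (c g^-1%g) Z) (\1_Z))%E.
Proof.
move=> cP mZ ht; have ng := action_nonsingular cP g.
have mr := measurable_RN_density ng.
have mind : measurable_fun setT (\1_Z : X -> R) by exact: measurable_indic.
have mt : measurable_fun setT (fun y => \1_Z y - t : R) by exact: measurable_funB.
have mc := measurable_action cP.
apply: ae_ge0_le_integral => //.
- by move=> x _; rewrite lee_fin sqr_ge0.
- apply/measurable_EFinP; apply: measurable_funX; apply: measurable_funB => //.
  exact: measurable_koopman.
- apply/measurable_EFinP; apply: measurableT_comp => //; apply: measurable_funB => //.
  by apply: measurable_funM => //; exact: measurableT_comp.
have h : {ae nu, forall x, t * Num.sqrt (RN_density nu (c g) x) = t}.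
  have [->|t0] := eqVneq t 0; first by apply: aeW => x; rewrite mul0r.
  by apply: filterS (ht t0) => x; rewrite /koopman mulr1 => ->; rewrite mulr1.
apply: filterS h => x h _; rewrite lee_fin.
have sqrt_ind y : Num.sqrt (\1_Z y : R) = \1_Z y.
  by rewrite indicE; case: (_ \in Z); rewrite ?sqrtr1 ?sqrtr0.
have -> : koopman nu c g (fun y => \1_Z y - t) x - (\1_Z x - t) =
    Num.sqrt (U1 nu (c g) (c g^-1%g) Z x) - Num.sqrt (\1_Z x).
  rewrite /U1 sqrtrM ?RN_density_ge0// !sqrt_ind /koopman mulrBr.
  by rewrite [X in _ - X - _]mulrC h; ring.
by apply: sqr_sub_sqrt_le => //; rewrite mulr_ge0// RN_density_ge0.
Qed.

Lemma integral_shifted_indic (Z : set X) (z t : R) : measurable Z ->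
  nu Z = z%:E ->
  (\int[nu]_x (\1_Z x - t)%:E = (z - t)%:E)%E /\
  (\int[nu]_x ((\1_Z x - t) ^+ 2)%:E = ((1 - 2 * t) * z + t ^+ 2)%:E)%E.
Proof.
move=> mZ zE.
have lin (p q : R) : (\int[nu]_x (p * \1_Z x + q)%:E = (p * z + q)%:E)%E.
  have iZ : nu.-integrable setT (EFin \o (\1_Z : X -> R)).
    exact: integrable_indic.
  have ic : nu.-integrable setT (EFin \o cst q) by exact: finite_measure_integrable_cst.
  under eq_integral do rewrite EFinD.
  rewrite (@integralD _ _ _ nu setT measurableT (fun x => (p * \1_Z x)%:E)
    (EFin \o cst q))//; last first.
    exact: (integrableZl measurableT p iZ).
  under eq_integral do rewrite EFinM.
  rewrite integralZl// integral_indic// setIT.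
  rewrite [X in (_ * X + _)%E]zE.
  rewrite -[X in (_ + X)%E]/(\int[nu]_x cst q%:E x)%E integral_cst//.
  by rewrite [X in (_ + _ * X)%E]probability_setT mule1.
split.
  by rewrite -[z]mul1r -lin; apply: eq_integral => x _; rewrite mul1r.
rewrite -lin; apply: eq_integral => x _; congr EFin; rewrite indicE.
by case: (x \in Z) => /=; ring.
Qed.

End Displacement.

Lemma not_ergodic_limit {R : realType} (G : groupType) {d : measure_display}
    {X : measurableType d} (nu : probability X R) (mu : G -> R)
    (b : G -> X -> X) (Z : set X) (z : R) :
  countable [set: G] -> property_T (R := R) G ->
  probability_on mu -> generating mu ->
  measurable Z -> nu Z = z%:E -> 0 < z < 1 ->
  (forall g, {ae nu, forall x, U1 nu (b g) (b g^-1%g) Z x = \1_Z x}) ->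
  ~ closure_in nu (A_mu nu mu) (@ergodic R d X nu G) b.
Proof.
move=> cG TG mu1 mugen mZ zE /andP[z0 z1] bZ [[bP _] clb].
have [Q hQ] := countable_enum_seq cG.
have /choice[c hc] k : exists c, [/\ A_mu nu mu c, ergodic nu c &
    weak_nbhd nu b (Q k) 1 (fun=> Z) (k.+1%:R^-1) c].
  by apply: clb; rewrite invr_gt0.
have cmu k : A_mu nu mu (c k) by case: (hc k).
have cP k : nonsingular_action nu (c k) by case: (cmu k).
have cerg k : ergodic nu (c k) by case: (hc k).
pose M := [set k | forall g, {ae nu, forall x, koopman nu (c k) g (cst 1) x = 1}].
pose t k : R := if `[< M k >] then z else 0.
have tM k : t k != 0 -> M k.
  by rewrite /t; case: asboolP => //; rewrite eqxx.
have [shift1 shift2] : (forall k, \int[nu]_x (\1_Z x - t k)%:E = (z - t k)%:E)%E /\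
    (forall k, \int[nu]_x ((\1_Z x - t k) ^+ 2)%:E =
       ((1 - 2 * t k) * z + t k ^+ 2)%:E)%E.
  by split=> k; have [] := integral_shifted_indic (t k) mZ zE.
(* The squared norm is [z] for [t k = 0] and [z * (1 - z)] for [t k = z]; a bound uniform in [k]
   makes small displacements small relative to the norm. *)
have q0 k : z * (1 - z) <= (1 - 2 * t k) * z + t k ^+ 2.
  by rewrite /t; case: asboolP => _; nra.
have zz : 0 < z * (1 - z) by nra.
have mind : measurable_fun setT (\1_Z : X -> R) by exact: measurable_indic.
have [|||||k [xi [mxi xi2 xiinv xiM]]] := @property_T_koopman _ _ _ nu G c M
  (fun k x => \1_Z x - t k) TG cP.
- by move=> k Mk g; exact: Mk.
- by move=> k; exact: measurable_funB.
- by move=> k; rewrite shift2 lte_fin ltry andbT (lt_le_trans zz).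
- by move=> k Mk; rewrite shift1 /t asboolT// subrr.
- move=> S e e0; have [N hN] := hQ S.
  (* Large enough for [Q k] to contain [S] and for the radius [k.+1%:R^-1] to beat the norm
     bound. *)
  pose k := maxn N (Num.bound (e * (z * (1 - z)))^-1).
  have ek : k.+1%:R^-1 < e * (z * (1 - z)).
    have ez : 0 < e * (z * (1 - z)) by rewrite mulr_gt0.
    rewrite invf_plt ?posrE//.
    apply: (lt_trans (archi_boundP _)); first by rewrite invr_ge0 ltW.
    by rewrite ltr_nat ltnS leq_maxr.
  exists k => g gS.
  apply: (le_lt_trans (koopman_displacement (cP k) mZ (fun h => tM k h g))).
  have [_ _ /(_ g 0%N)] := hc k.
  move=> /(_ (hN k (leq_maxl _ _) g gS) isT mZ) h.
  apply: (@le_lt_trans _ _ (k.+1%:R^-1)%:E); last first.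
    rewrite shift2 -EFinM lte_fin; apply: (lt_le_trans ek).
    by rewrite ler_wpM2l// ltW.
  apply: le_trans (ltW h); rewrite /L1dist le_eqVlt; apply/orP; left; apply/eqP.
  have mU (c' : G -> X -> X) : nonsingular_action nu c' ->
      measurable_fun setT (U1 nu (c' g) (c' g^-1%g) Z).
    by move=> c'P; apply/measurable_EFinP/(measurable_int nu)/integrable_U1.
  apply: ae_eq_integral => //.
  + apply/measurable_EFinP; apply: measurableT_comp => //; apply: measurable_funB => //.
    exact: mU.
  + apply/measurable_EFinP; apply: measurableT_comp => //; apply: measurable_funB => //.
      exact: mU.
    exact: mU.
  + by apply: filterS (bZ g) => x -> _.
(* Rigidity yields both that [k] lies in [M] and that the integral is nonzero, whereas [xiM] makes
   it zero on [M]. *)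
have [Mk nz] := invariant_vector_constant mu1 mugen (cmu k) (cerg k) mxi xi2 xiinv.
exact/nz/xiM.
Qed.

Theorem theorem1p4 (R : realType) (G : groupType) (d : measure_display)
    (X : measurableType d) (nu : probability X R) :
  countable [set: G] ->
  standard_nonatomic nu ->
  property_T (R := R) G ->
  forall mu : G -> R, probability_on mu -> generating mu ->
    nowhere_dense_in nu (A_mu nu mu) (@ergodic R d X nu G).
Proof.
move=> cG [f [g [mf mg fnu gf fg]]] TG mu mu1 mugen.
move=> [a [F [n [As [e [e0 amu close]]]]]].
have aP : nonsingular_action nu a by case: amu.
pose err h k := (\int[nu]_x (`|h (standard_dil_inv f g (dil_ratio k) x) *
       \1_(standard_range f (dil_ratio k)) x - h x|)%:E)%E : \bar R.
have err0 (h : X -> R) : nu.-integrable setT (EFin \o h) ->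
    \forall k \near \oo, (err h k < (e / 3)%:E)%E.
  by apply: standard_dilation_cvg => //; rewrite divr_gt0.
(* Only finitely many pairs of a group element and a set occur in the neighbourhood, so one ratio
   serves them all; the thirds match the three terms of [L1dist_glue]. *)
have near_err : \forall k \near \oo, forall p : G * nat,
    p \in [seq (h, i) | h <- F, i <- iota 0 n] -> measurable (As p.2) ->
    [/\ (err (\1_(As p.2)) k < (e / 3)%:E)%E,
        (err (U1 nu (a p.1) (a p.1^-1%g) (As p.2)) k < (e / 3)%:E)%E &
        (err (cst 1%R) k < (e / 3)%:E)%E].
  apply: near_seq => -[h i] /=.
  have [mA|nA] := pselect (measurable (As i)); last by apply: nearW => k /nA.
  have i1 : nu.-integrable setT (EFin \o (\1_(As i) : X -> R)) by exact: integrable_indic.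
  have i3 : nu.-integrable setT (EFin \o (cst 1 : X -> R)).
    exact: finite_measure_integrable_cst.
  by apply: filterS3 (err0 _ i1) (err0 _ (integrable_U1 h aP mA)) (err0 _ i3).
have [k hk] := filter_ex near_err.
have /andP[s0 s1] := @dil_ratio_itv R k.
have dil := standard_dilation mf mg fnu gf fg (@dil_ratio_itv R k).
set X0 := standard_range f _ in dil; set D := standard_dil f g _ in dil.
set D' := standard_dil_inv f g _ in dil; set s := dil_ratio k in dil.
have bmu := glue_A_mu dil mu1 amu.
have mX0 : measurable X0 := measurable_dilation_range dil.
have : closure_in nu (A_mu nu mu) (@ergodic R d X nu G) (glued X0 D D' a).
  apply: close => // h i hF hi mA.
  apply: (le_lt_trans (L1dist_glue dil amu h mA)).
  have [|//|h1 h2 h3] := hk (h, i).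
    by apply/allpairsP; exists (h, i); split => //=; rewrite mem_iota.
  have -> : e = e / 3 + (e / 3 + e / 3) by field.
  by rewrite !EFinD; apply: lteD => //; apply: lteD.
(* The fixed set is the complement of [X0]; a ratio strictly between 0 and 1 gives it intermediate
   measure. *)
apply: (@not_ergodic_limit _ _ _ _ _ _ _ (~` X0) (1 - s) cG TG mu1 mugen).
- exact: measurableC.
- by rewrite probability_setC// (measure_dilation_range dil).
- by rewrite subr_gt0 s1 ltrBlDr ltrDl.
- by move=> h; exact: (U1_glue_fixed dil amu).
Qed.
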